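(* For integers $n\ge 1$ and $k\geq 0$, let $\mathcal L_{n,k}$ be the finite set of words of length $k$ which are maximal lexicographic representatives of elements of the positive braid monoid $A_n$. Let $$P_{n,1}=\lim_{k\to\infty}\frac{\#\{w\in\mathcal L_{n,k}\;:\; \text{the last letter of } w \text{ is } a_1\}}{\#\mathcal L_{n,k}}.$$ Then $P_{n,1}>\frac18$ for every $n\ge 1$.
   Context: For $n\ge 1$, $A_n$ is the positive braid monoid with $n$ generators, i.e. the monoid with generators $a_1,\ldots,a_n$ and relations $a_ia_j=a_ja_i$ if $|i-j|>1$, and $a_ia_ja_i=a_ja_ia_j$ if $|i-j|=1$. The relations are homogeneous, so all words in $a_1,\dots,a_n$ representing a given element have the same length, which is the length of the element. Order the letters by $a_1<a_2<\cdots<a_n$. The maximal lexicographic representative of $\beta\in A_n$ is the lexicographically biggest word among the finitely many words (in the letters $a_1,\dots,a_n$) representing $\beta$. The limit defining $P_{n,1}$ is well defined (it exists). *)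

(* Defs.v *)
From HB Require Import structures.
From mathcomp Require Import all_boot all_order all_algebra generic_quotient.
From mathcomp Require Import all_classical all_reals all_analysis.

Set Implicit Arguments.
Unset Strict Implicit.
Unset Printing Implicit Defensive.

Import Order.TTheory GRing.Theory Num.Theory.
Import numFieldNormedType.Exports.

Local Open Scope quotient_scope.
Local Open Scope ring_scope.

(* The generator a_i is the ordinal of value i - 1, so that the order on the
   letters a_1 < ... < a_n is the order of ordinals and a_1 has value 0. *)
Section BraidMonoid.
Variable n : nat.

Inductive braid_relation : seq 'I_n -> seq 'I_n -> Prop :=
| braid_far (i j : 'I_n) : (i.+1 < j)%N || (j.+1 < i)%N ->
    braid_relation [:: i; j] [:: j; i]
| braid_adjacent (i j : 'I_n) : (i.+1 == j)%N || (j.+1 == i)%N ->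
    braid_relation [:: i; j; i] [:: j; i; j].

Inductive braid_equiv : seq 'I_n -> seq 'I_n -> Prop :=
| braid_equiv_step u v w w' : braid_relation w w' ->
    braid_equiv (u ++ w ++ v) (u ++ w' ++ v)
| braid_equiv_refl w : braid_equiv w w
| braid_equiv_sym w w' : braid_equiv w w' -> braid_equiv w' w
| braid_equiv_trans w1 w2 w3 :
    braid_equiv w1 w2 -> braid_equiv w2 w3 -> braid_equiv w1 w3.

Definition braid_eq : rel (seq 'I_n) := fun w w' => `[< braid_equiv w w' >].

Lemma braid_eq_is_equiv : equiv_class_of braid_eq.
Proof.
split=> [w|w w'|w2 w1 w3].
- exact/asboolP/braid_equiv_refl.
- by apply/asboolP/asboolP; exact: braid_equiv_sym.
- by move=> /asboolP h1 /asboolP h2; apply/asboolP; exact: braid_equiv_trans h2.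
Qed.

Canonical braid_eq_equiv := EquivRelPack braid_eq_is_equiv.

Definition braid_monoid := {eq_quot braid_eq}.

HB.instance Definition _ := Choice.on braid_monoid.
HB.instance Definition _ := Quotient.on braid_monoid.
HB.instance Definition _ := EqQuotient.on braid_monoid.

Definition word_class (w : seq 'I_n) : braid_monoid := \pi_braid_monoid w.

Lemma word_classP (w w' : seq 'I_n) :
  word_class w = word_class w' <-> braid_equiv w w'.
Proof. by split=> [/eqmodP/asboolP|h] //; apply/eqmodP/asboolP. Qed.

Lemma braid_equiv_cat (u u' v v' : seq 'I_n) :
  braid_equiv u u' -> braid_equiv v v' -> braid_equiv (u ++ v) (u' ++ v').
Proof.
move=> uu' vv'; apply: (@braid_equiv_trans _ (u' ++ v)).
  elim: uu' => [x y w w' h|w|w w' _ h|w1 w2 w3 _ h1 _ h2].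
  - by rewrite -!catA; exact: braid_equiv_step.
  - exact: braid_equiv_refl.
  - exact: braid_equiv_sym.
  - exact: braid_equiv_trans h1 h2.
elim: vv' => [x y w w' h|w|w w' _ h|w1 w2 w3 _ h1 _ h2].
- by rewrite !(catA u'); exact: braid_equiv_step.
- exact: braid_equiv_refl.
- exact: braid_equiv_sym.
- exact: braid_equiv_trans h1 h2.
Qed.

Definition braid_one : braid_monoid := word_class [::].
Definition braid_mul (b c : braid_monoid) : braid_monoid :=
  word_class (repr b ++ repr c).

Lemma braid_mulE (u v : seq 'I_n) :
  braid_mul (word_class u) (word_class v) = word_class (u ++ v).
Proof.
by apply/word_classP/braid_equiv_cat; apply/word_classP; rewrite /word_class reprK.
Qed.

Lemma word_class_repr (b : braid_monoid) : word_class (repr b) = b.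
Proof. exact: reprK. Qed.

Lemma braid_mulA : associative braid_mul.
Proof.
move=> b c d; rewrite -(word_class_repr b) -(word_class_repr c).
by rewrite -(word_class_repr d) !braid_mulE catA.
Qed.

Lemma braid_mul1 : left_id braid_one braid_mul.
Proof. by move=> b; rewrite -(word_class_repr b) braid_mulE. Qed.

Lemma braid_mulr1 : right_id braid_one braid_mul.
Proof. by move=> b; rewrite -(word_class_repr b) braid_mulE cats0. Qed.

HB.instance Definition _ :=
  isMonoid.Build braid_monoid braid_mulA braid_mul1 braid_mulr1.

Definition is_max_lex_rep (b : braid_monoid) (w : seq 'I_n) : Prop :=
  word_class w = b /\
  forall v : seq 'I_n, word_class v = b -> ((v : seqlexi 'I_n) <= w)%O.

Definition max_lex_words (k : nat) : {set k.-tuple 'I_n} :=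
  [set w : k.-tuple 'I_n | `[< exists b, is_max_lex_rep b w >]]%SET.

Definition ends_with_a1 (w : seq 'I_n) : bool :=
  if w is i :: w' then nat_of_ord (last i w') == 0%N else false.

End BraidMonoid.

Definition proportion_a1 (R : realType) (n k : nat) : R :=
  #|[set w in max_lex_words n k | ends_with_a1 w]%SET|%:R
    / #|max_lex_words n k|%:R.

(* The analysis library's [lim] is 0 for a divergent real sequence, so a
   positive lower bound on [P_n1] also asserts that the limit exists. *)
Definition P_n1 (R : realType) (n : nat) : R :=
  limn (fun k => proportion_a1 R n k).

(* Main.v *)
Require Import Defs.
From mathcomp Require Import all_boot all_order all_algebra.
From mathcomp Require Import all_classical all_reals all_analysis.
From mathcomp Require Import zify ring lra.
From Stdlib Require Setoid.

(* Letters are numbered from 0, so a_1 is 0. Call a word maximal if it is a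
   maximal lexicographic representative. Garside's lemma gives cancellation and
   lcms for left divisibility, and the divisors of the half twist (the simple
   elements) contain no square and are stable under residues. Two consequences:

   - Squares synchronise: if u 0 and 0 v are maximal, so is u 0 0 v. Every
     maximal word can be prolonged by a bounded number of letters to one ending
     in 0 0, and words are dominated by words starting with 0, so the proportion
     of words ending in 0 converges by Doeblin's contraction argument.

   - If w is maximal and w 0 is not, then w = x 0 1 y with all letters of y at
     least 2. Such a w is sent injectively to a word of the same length that can
     be prolonged by 0, namely x 0 1 y' with y' the downward shift of y if y is
     nonempty, and x 0 0 otherwise. Hence at least half of the maximal words of
     length k can be prolonged by 0.

   As consecutive letters i j of a maximal word satisfy j <= i + 1, the growth
   rate is strictly less than 4 (a transfer inequality for walks on n letters),
   so the limit exceeds (1/2)(1/4). *)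

Set Implicit Arguments.
Unset Strict Implicit.
Unset Printing Implicit Defensive.

(** * Positive braids: left divisibility and simple elements *)

Definition far (i j : nat) := (i.+1 < j) || (j.+1 < i).
Definition adj (i j : nat) := (i.+1 == j) || (j.+1 == i).

(** The relations apply at the head and only left contexts are built in, so that induction on a
    derivation follows first letters. Letters are unbounded; the restriction to [n] generators
    returns at the end. *)
Inductive weq : seq nat -> seq nat -> Prop :=
| weq_far i j w : far i j -> weq (i :: j :: w) (j :: i :: w)
| weq_adj i j w : adj i j -> weq (i :: j :: i :: w) (j :: i :: j :: w)
| weq_cons i w w' : weq w w' -> weq (i :: w) (i :: w')
| weq_refl w : weq w w
| weq_sym w w' : weq w w' -> weq w' w
| weq_trans w1 w2 w3 : weq w1 w2 -> weq w2 w3 -> weq w1 w3.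

#[local] Hint Resolve weq_refl weq_cons : core.

#[local] Instance weq_Equivalence : RelationClasses.Equivalence weq.
Proof.
by split=> [w|w w'|w1 w2 w3];
  [exact: weq_refl | exact: weq_sym | exact: weq_trans].
Qed.

#[local] Instance cons_weq_Proper (i : nat) :
  Morphisms.Proper (Morphisms.respectful weq weq) (cons i).
Proof. by move=> w w'; exact: weq_cons. Qed.

Lemma weq_catl u w w' : weq w w' -> weq (u ++ w) (u ++ w').
Proof. by move=> h; elim: u => //= i u; exact: weq_cons. Qed.

Lemma weq_catr u w w' : weq w w' -> weq (w ++ u) (w' ++ u).
Proof.
elim=> {w w'} [i j w|i j w|i w w' _|w|w w' _|w1 w2 w3 _ h1 _ h2] /=.
- exact: weq_far.
- exact: weq_adj.
- exact: weq_cons.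
- exact: weq_refl.
- exact: weq_sym.
- exact: weq_trans h1 h2.
Qed.

#[local] Instance cat_weq_Proper : Morphisms.Proper
  (Morphisms.respectful weq (Morphisms.respectful weq weq)) cat.
Proof.
move=> u u' uu' v v' vv'.
exact: weq_trans (weq_catr _ uu') (weq_catl _ vv').
Qed.

Lemma weq_size w w' : weq w w' -> size w = size w'.
Proof. by elim=> //= [i w1 w2 _ -> //|w1 w2 w3 _ -> _ ->]. Qed.

Lemma weq_mem w w' : weq w w' -> w =i w'.
Proof.
elim=> {w w'} [i j w _|i j w _|i w w' _ h|w|w w' _ h|w1 w2 w3 _ h1 _ h2] x;
  rewrite ?inE ?h ?h1 ?h2 //; lia.
Qed.

(** * Garside's lemma on common multiples of two letters *)

Lemma letter_cases i j : [\/ i = j, far i j | adj i j].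
Proof.
have [->|h] := eqVneq i j; first exact: Or31.
have [f|f] := boolP (far i j); first exact: Or32.
by apply: Or33; move: h f; rewrite /far /adj; lia.
Qed.

Lemma farC i j : far i j = far j i. Proof. by rewrite /far orbC. Qed.
Lemma adjC i j : adj i j = adj j i. Proof. by rewrite /adj orbC. Qed.

Variant head_lcm i x j y : Prop :=
| HeadEq of i = j & weq x y
| HeadFar z of far i j & weq x (j :: z) & weq y (i :: z)
| HeadAdj z of adj i j & weq x (j :: i :: z) & weq y (i :: j :: z).

Lemma head_lcm_sym i x j y : head_lcm i x j y -> head_lcm j y i x.
Proof.
case=> [-> h|z f h1 h2|z f h1 h2].
- by apply: HeadEq => //; exact: weq_sym.
- by apply: (@HeadFar _ _ _ _ z); rewrite // farC.
- by apply: (@HeadAdj _ _ _ _ z); rewrite // adjC.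
Qed.

Section HeadTransitivity.
Variable l : nat.
Hypothesis IH : forall i x j y,
  (size x < l)%N -> weq (i :: x) (j :: y) -> head_lcm i x j y.

Lemma ih_cancel i x y : size x < l -> weq (i :: x) (i :: y) -> weq x y.
Proof. by move=> s /(IH s)[]// z; rewrite /far /adj; lia. Qed.

Lemma ih_far i j x y : far i j -> size x < l -> weq (i :: x) (j :: y) ->
  exists z, weq x (j :: z) /\ weq y (i :: z).
Proof.
move=> f s /(IH s)[e|z _ h1 h2|z a _ _].
- by move: f; rewrite e /far; lia.
- by exists z.
- by move: f a; rewrite /far /adj; lia.
Qed.

Lemma ih_adj i j x y : adj i j -> size x < l -> weq (i :: x) (j :: y) ->
  exists z, weq x (j :: i :: z) /\ weq y (i :: j :: z).
Proof.
move=> a s /(IH s)[e|z f _ _|z _ h1 h2].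
- by move: a; rewrite e /adj; lia.
- by move: f a; rewrite /far /adj; lia.
- by exists z.
Qed.

(** Chains two equivalences through the head [k]. Each relative position of [i], [k], [j] is a
    computation of the lcm of the three letters; tails after [k] are shorter than [l], so [IH]
    applies to them. *)
Lemma ih_trans i x k u j y : size x < l.+1 -> size u < l.+1 ->
  head_lcm i x k u -> head_lcm k u j y -> head_lcm i x j y.
Proof.
move=> sx su.
case=> [-> xu|z f xz uz|z a xz uz].
- case=> [-> uy|z' f uz' yz'|z' a uz' yz'].
  + by apply: HeadEq => //; rewrite xu.
  + by apply: (HeadFar f _ yz'); rewrite xu.
  + by apply: (HeadAdj a _ yz'); rewrite xu.
- have sz : size z < l by have := weq_size uz => /=; lia.
  case=> [e uy|z' f' uz' yz'|z' a' uz' yz'].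
  + by subst k; apply: (HeadFar f xz); rewrite -uy.
  + have /(weq_trans (weq_sym uz)) e := uz'.
    case: (letter_cases i j) => [ij|ij|ij].
    * subst j; have {e} zz' := ih_cancel sz e.
      by apply: HeadEq => //; rewrite xz yz' zz'.
    * have [w [zw z'w]] := ih_far ij sz e.
      apply: (@HeadFar _ _ _ _ (k :: w)) => //.
        by rewrite xz zw; exact: weq_far.
      by rewrite yz' z'w; apply: weq_far; rewrite farC.
    * have [w [zw z'w]] := ih_adj ij sz e.
      apply: (@HeadAdj _ _ _ _ (k :: w)) => //.
        by rewrite xz zw (weq_far _ f') (@weq_far k i _) // farC.
      by rewrite yz' z'w -(weq_far _ f) -(@weq_far k j).
  + have /(weq_trans (weq_sym uz)) e := uz'.
    case: (letter_cases i j) => [ij|ij|ij].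
    * by subst j; move: f a'; rewrite /far /adj; lia.
    * have [w [zw z'w]] := ih_far ij sz e.
      have sz' : size (k :: z') = size (i :: w) by exact: weq_size.
      have szw : size z = size (j :: w) by exact: weq_size.
      have sz'l : size z' < l by move: sz' szw sz => /=; lia.
      have fk : far k i by rewrite farC.
      have [v [z'v wv]] := ih_far fk sz'l z'w.
      apply: (@HeadFar _ _ _ _ (k :: j :: v)) => //.
        by rewrite xz zw wv; exact: weq_adj.
      by rewrite yz' z'v (@weq_far j i) 1?farC // (@weq_far k i).
    * have [w [zw z'w]] := ih_adj ij sz e.
      have sz' : size (k :: z') = size (i :: j :: w) by exact: weq_size.
      have szw : size z = size (j :: i :: w) by exact: weq_size.
      have sz'l : size z' < l by move: sz' szw sz => /=; lia.
      have fk : far k i by rewrite farC.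
      have [v [z'v wv]] := ih_far fk sz'l z'w.
      have swl : size w < l by move: szw sz => /=; lia.
      have ajk : adj j k by rewrite adjC.
      have [t [wt vt]] := ih_adj ajk swl wv.
      have aji : adj j i by rewrite adjC.
      apply: (@HeadAdj _ _ _ _ (k :: j :: i :: t)) => //.
        rewrite xz zw wt (@weq_far i k) // (@weq_adj k j) //.
        by rewrite -(@weq_adj i j) // -(@weq_far i k).
      rewrite yz' z'v vt (@weq_adj j i) // (@weq_far k i) //.
      by rewrite (@weq_far i k t) // -(@weq_adj j k).
- have sz : size (k :: z) < l by have := weq_size uz => /=; lia.
  have aki : adj k i by rewrite adjC.
  case=> [e uy|z' f' uz' yz'|z' a' uz' yz'].
  + by subst k; apply: (HeadAdj a xz); rewrite -uy.
  + have /(weq_trans (weq_sym uz)) e := uz'.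
    have fjk : far j k by rewrite farC.
    case: (letter_cases i j) => [ij|ij|ij].
    * by subst j; move: f' a; rewrite /far /adj; lia.
    * have [w [zw z'w]] := ih_far ij sz e.
      have szl : size z < l by move: sz => /=; lia.
      have [v [zv wv]] := ih_far f' szl zw.
      apply: (@HeadFar _ _ _ _ (k :: i :: v)) => //.
        by rewrite xz zv (@weq_far i j) // (@weq_far k j).
      by rewrite yz' z'w wv (@weq_adj k i).
    * have [w [zw z'w]] := ih_adj ij sz e.
      have szl : size z < l by move: sz => /=; lia.
      have [v [zv wv]] := ih_far f' szl zw.
      have swl : size w < l by move: (weq_size zw) szl => /=; lia.
      have [t [wt vt]] := ih_adj a swl wv.
      have aji : adj j i by rewrite adjC.
      apply: (@HeadAdj _ _ _ _ (k :: i :: j :: t)) => //.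
        rewrite xz zv vt (@weq_adj i j) // (@weq_far k j) //.
        by rewrite (@weq_far j k t) // (@weq_adj k i).
      rewrite yz' z'w wt (@weq_far j k) // (@weq_adj k i) //.
      by rewrite (@weq_adj i j) // (@weq_far k j).
  + have /(weq_trans (weq_sym uz)) e := uz'.
    have ajk : adj j k by rewrite adjC.
    case: (letter_cases i j) => [ij|ij|ij].
    * subst j; have {e} zz' := ih_cancel sz e.
      have szl : size z < l by move: sz => /=; lia.
      have zz : weq z z' := ih_cancel szl zz'.
      by apply: HeadEq => //; rewrite xz yz' zz.
    (* Here [i] and [j] commute and both are adjacent to [k]: the lcm is the half twist on three
       generators, of length 6. *)
    * have [w [zw z'w]] := ih_far ij sz e.
      have szl : size z < l by move: sz => /=; lia.
      have szz' : size z' < l.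
        by move: (weq_size z'w) (weq_size zw) szl => /=; lia.
      have swl : size w < l by move: (weq_size zw) szl => /=; lia.
      have [v [zv wv]] := ih_adj a' szl zw.
      have [v' [zv' wv']] := ih_adj aki szz' z'w.
      have e2 : weq (k :: j :: v) (k :: i :: v') by rewrite -wv -wv'.
      have sjv : size (j :: v) < l by move: (weq_size wv) swl => /=; lia.
      have {e2} e2 := ih_cancel sjv e2.
      have fji : far j i by rewrite farC.
      have svl : size v < l by move: sjv => /=; lia.
      have [t [vt v't]] := ih_far fji svl e2.
      apply: (@HeadFar _ _ _ _ (k :: i :: j :: k :: t)) => //.
        rewrite xz zv vt (@weq_far i j) // (@weq_adj i k) //.
        by rewrite (@weq_adj k j) // (@weq_far j i).
      rewrite yz' zv' v't (@weq_far j i) // (@weq_adj j k) //.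
      by rewrite (@weq_adj k i) //.
    (* Three letters are never pairwise adjacent. *)
    * by move: a a' ij; rewrite /adj; lia.
Qed.
End HeadTransitivity.

(* Garside's key lemma; the induction is on the length, and transitivity inside
   a fixed length is the only place where the cube condition enters. *)
Lemma garside i x j y : weq (i :: x) (j :: y) -> head_lcm i x j y.
Proof.
elim/ltn_ind: (size x) {-2}x (erefl (size x)) i j y => l IH {}x sx i j y xy.
have IH' i' x' j' y' : (size x' < l)%N -> weq (i' :: x') (j' :: y') ->
    head_lcm i' x' j' y' by move=> s; exact: IH s _ erefl _ _ _.
suff main : forall w w', weq w w' -> forall i x j y, size x = l ->
    w = i :: x -> w' = j :: y -> head_lcm i x j y.
  exact: main xy _ _ _ _ sx erefl erefl.
move=> w w'; elim=> {w w' i x j y sx xy}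
  [i j w f|i j w a|i w w' ww' _|w|w w' ww' h|w1 w2 w3 h12 h1 _ h2]
  i' x' j' y' sx.
- by move=> [<- <-] [<- <-]; exact: (HeadFar f).
- by move=> [<- <-] [<- <-]; exact: (HeadAdj a).
- by move=> [<- <-] [<- <-]; exact: HeadEq.
- by move=> -> [<- <-]; exact: HeadEq.
- move=> e1 e2; apply: head_lcm_sym; apply: h => //.
  by move: (weq_size ww'); rewrite e1 e2 /=; lia.
- move=> e1 e2.
  case: w2 h12 h1 h2 => [|k u] h12 h1 h2.
    by move: (weq_size h12); rewrite e1.
  have su : size u = l by move: (weq_size h12); rewrite e1 /=; lia.
  by apply: (ih_trans IH' _ _ (h1 _ _ _ _ sx e1 erefl) (h2 _ _ _ _ su erefl e2));
    rewrite ?sx ?su.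
Qed.

Lemma cancel_cons i x y : weq (i :: x) (i :: y) -> weq x y.
Proof. by move=> /garside[]// z; rewrite /far /adj; lia. Qed.

Lemma cancel_catl u x y : weq (u ++ x) (u ++ y) -> weq x y.
Proof. by elim: u => //= i u IH /cancel_cons. Qed.

Lemma garside_far i j x y : far i j -> weq (i :: x) (j :: y) ->
  exists z, weq x (j :: z) /\ weq y (i :: z).
Proof. by move=> f /(ih_far (fun i x j y _ => @garside i x j y) f (ltnSn _)). Qed.

Lemma garside_adj i j x y : adj i j -> weq (i :: x) (j :: y) ->
  exists z, weq x (j :: i :: z) /\ weq y (i :: j :: z).
Proof. by move=> a /(ih_adj (fun i x j y _ => @garside i x j y) a (ltnSn _)). Qed.

(** * Left divisibility and residues *)

Definition ldiv (s w : seq nat) := exists t, weq w (s ++ t).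

Lemma ldiv_weq s w s' w' : weq s s' -> weq w w' -> ldiv s w -> ldiv s' w'.
Proof. by move=> ss ww [t h]; exists t; rewrite -ww -ss. Qed.

Lemma ldiv0 w : ldiv [::] w. Proof. by exists w. Qed.

Lemma ldiv_catr s t : ldiv s (s ++ t). Proof. by exists t. Qed.

Lemma ldiv_refl s : ldiv s s. Proof. by exists [::]; rewrite cats0. Qed.

Lemma ldiv_trans s w w' : ldiv s w -> ldiv w w' -> ldiv s w'.
Proof. by move=> [t h] [t' h']; exists (t ++ t'); rewrite h' h catA. Qed.

Lemma ldiv_cons i s w : ldiv (i :: s) (i :: w) <-> ldiv s w.
Proof.
by split=> [[t /= /cancel_cons h]|[t h]]; exists t => //=; exact: weq_cons.
Qed.

Lemma ldiv_cat u s w : ldiv (u ++ s) (u ++ w) <-> ldiv s w.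
Proof. by elim: u => //= i u <-; exact: ldiv_cons. Qed.

Lemma ldiv_size s w : ldiv s w -> size s <= size w.
Proof. by case=> t /weq_size ->; rewrite size_cat; lia. Qed.

Lemma ldiv_mem s w i : ldiv s w -> i \in s -> i \in w.
Proof. by case=> t /weq_mem ->; rewrite mem_cat => ->. Qed.

Lemma ldiv1 i s w : ldiv (i :: s) w -> ldiv [:: i] w.
Proof. by case=> t h; exists (s ++ t). Qed.

(** The word [q :: s'] is the lcm of [s] and [q]. It is built by completing Garside squares along
    [s], with induction on the common multiple; an adjacent first letter [i] needs two residues in
    turn, by [q] and then by [i]. *)
Lemma residue_exists s q b : ldiv s (q :: b) ->
  exists s', [/\ ldiv s' b, ldiv s (q :: s') &
    forall c, ldiv s (q :: c) -> ldiv s' c].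
Proof.
elim/ltn_ind: (size b) {-2}b (erefl (size b)) s q => l IH {}b sb [|i t] q.
  by move=> _; exists [::]; split=> // *; exact: ldiv0.
case=> e /= qb; case: (letter_cases q i) => [qi|qi|qi].
- subst i; exists t; split=> //; first by exists e; exact: cancel_cons qb.
    exact: ldiv_refl.
  by move=> c /ldiv_cons.
- have [b' [bb' teb']] := garside_far qi qb.
  have sb' : size b' < l by rewrite -sb (weq_size bb').
  have tq : ldiv t (q :: b') by exists e; rewrite -teb'.
  have [t' [t'b' tt' mint']] := IH _ sb' _ erefl _ _ tq.
  exists (i :: t'); split.
  + by apply: (ldiv_weq _ (weq_sym bb')) (proj2 (ldiv_cons i _ _) t'b').
  + apply: (@ldiv_weq (i :: t) (i :: q :: t')) => //.
      by apply: weq_far; rewrite farC.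
    exact/ldiv_cons.
  + move=> c [f /= qc]; have [c' [cc' tfc']] := garside_far qi qc.
    apply: (ldiv_weq _ (weq_sym cc')) (proj2 (ldiv_cons i _ _) _) => //.
    by apply: mint'; exists f; rewrite -tfc'.
- have [b' [bb' teb']] := garside_adj qi qb.
  have sib' : size (i :: b') < l by rewrite -sb (weq_size bb').
  have tq : ldiv t (q :: i :: b') by exists e; rewrite -teb'.
  have [t1 [t1b' tt1 mint1]] := IH _ sib' _ erefl _ _ tq.
  have sb' : size b' < l by rewrite -sb (weq_size bb') /=; lia.
  have [t2 [t2b' t12 mint2]] := IH _ sb' _ erefl _ _ t1b'.
  exists (i :: q :: t2); split.
  + apply: (ldiv_weq _ (weq_sym bb')) (_ : ldiv (i :: q :: t2) _) => //.
    by do 2 apply/ldiv_cons.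
  + apply: (@ldiv_weq (i :: t) (i :: q :: i :: t2)) => //.
      by apply: weq_adj; rewrite adjC.
    apply/ldiv_cons; apply: ldiv_trans tt1 _; exact/ldiv_cons.
  + move=> c [f /= qc]; have [c' [cc' tfc']] := garside_adj qi qc.
    apply: (ldiv_weq _ (weq_sym cc')) (_ : ldiv (i :: q :: t2) _) => //.
    do 2 apply/ldiv_cons.
    by apply: mint2; apply: mint1; exists f; rewrite -tfc'.
Qed.

(** * The half twist and its divisors *)

Lemma weq_far_word i u w : all (far i) u -> weq (i :: u ++ w) (u ++ i :: w).
Proof.
by elim: u => //= j u IH /andP[f fu]; rewrite (weq_far _ f) (IH fu).
Qed.

Lemma ldiv_far_word i s u y : all (far i) u -> ldiv (i :: s) (u ++ y) ->
  exists y', weq y (i :: y') /\ ldiv s (u ++ y').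
Proof.
elim: u s => [|j u IH] s /=.
  by move=> _ [t h]; exists (s ++ t); split=> //; exists t.
move=> /andP[f fu] [t /= h]; rewrite farC in f.
have [z [h1 h2]] := garside_far f h.
have [|y' [yy' [t' uy']]] := IH [::] fu; first by exists z; rewrite h1.
exists y'; split=> //; exists t.
have : weq (i :: u ++ y') (i :: z) by rewrite weq_far_word // -yy' h1.
by move=> /cancel_cons ->; rewrite h2.
Qed.

Lemma iota_far i a k : (i.+1 < a) || (a + k < i) -> all (far i) (iota a k).
Proof. by move=> h; apply/allP => j; rewrite mem_iota /far; lia. Qed.

(** Only the block [i, i.+1] interacts with the letter [i], through one braid relation; all other
    letters commute past. *)
Lemma iota_shift N i w : i.+1 < N ->
  weq (iota 0 N ++ i :: w) (i.+1 :: iota 0 N ++ w).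
Proof.
move=> iN.
have -> : iota 0 N = iota 0 i ++ [:: i; i.+1] ++ iota i.+2 (N - i.+2).
  have {1}-> : N = i + (2 + (N - i.+2)) by lia.
  by rewrite iotaD add0n iotaD addn2.
set r := iota i.+2 _; rewrite -!catA /= -(@weq_far_word i r); last first.
  by apply: iota_far; lia.
rewrite (@weq_adj i i.+1) ?/adj ?eqxx //.
by rewrite -(@weq_far_word i.+1 (iota 0 i)) //; apply: iota_far; lia.
Qed.

Lemma iota_shift_word N u w : all (fun i => i.+1 < N) u ->
  weq (iota 0 N ++ u ++ w) (map S u ++ iota 0 N ++ w).
Proof.
by elim: u => //= i u IH /andP[iN uN]; rewrite iota_shift // IH.
Qed.

(** Garside's half twist on [N] generators. *)
Fixpoint delta N := if N is N'.+1 then iota 0 N'.+1 ++ delta N' else [::].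

Lemma delta_letters N : all (fun i => i < N) (delta N).
Proof.
elim: N => //= N IH; rewrite all_cat; apply/andP; split.
  by apply/allP => i; rewrite mem_iota; lia.
by apply: sub_all IH => i; lia.
Qed.

Lemma ldiv_iota i k y :
  ldiv [:: i] (iota i.+1 k ++ y) -> ldiv (iota i k.+1) y.
Proof.
elim: k i y => [//|k IH] i y [t /= h].
have a : adj i.+1 i by rewrite /adj eqxx orbT.
have [z [h1 _]] := garside_adj a h.
have f : all (far i) (iota i.+2 k) by apply: iota_far; lia.
have /(ldiv_far_word f)[y' [yy' /IH h2]] :
  ldiv [:: i; i.+1] (iota i.+2 k ++ y) by exists z.
exact: ldiv_weq (weq_sym yy') (proj2 (ldiv_cons _ _ _) h2).
Qed.

(** Source of the properties of simple elements: [ldiv d (delta N)] keeps suffixes simple, and [~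
    ldiv [:: q] d] forbids squares. *)
Lemma delta_head N q : q < N -> exists d,
  [/\ weq (delta N) (q :: d), ldiv d (delta N) & ~ ldiv [:: q] d].
Proof.
elim: N q => // N IH [_|q qN].
(* Appending the letter [N] to this cofactor gives [delta N.+1] back. *)
- exists (iota 1 N ++ delta N); split=> //.
  + exists [:: N]; case: {IH} N => // N.
    have e : delta N.+2 = iota 0 N.+2 ++ iota 0 N.+1 ++ delta N by [].
    have {}e : weq (delta N.+2) (map S (iota 0 N.+1) ++ iota 0 N.+2 ++ delta N).
      rewrite e; apply: iota_shift_word.
      by apply/allP => i; rewrite mem_iota; lia.
    have e2 : iota 0 N.+2 = iota 0 N.+1 ++ [:: N.+1].
      by rewrite -addn1 iotaD.
    have -> : delta N.+1 = iota 0 N.+1 ++ delta N by [].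
    have -> : iota 1 N.+1 = map S (iota 0 N.+1) by rewrite -(iotaDl 1).
    rewrite e -!catA; apply: weq_catl; rewrite e2 -catA; apply: weq_catl.
    rewrite /= -[X in weq _ X]weq_far_word ?cats0 //.
    by apply: sub_all (delta_letters N) => i; rewrite /far; lia.
  (* If 0 divided the cofactor, [0 ... N] would divide [delta N], whose letters are below [N]. *)
  + move=> /ldiv_iota/ldiv_mem -/(_ N); rewrite mem_iota => h.
    have /h : 0 <= N < 0 + N.+1 by lia.
    by move=> /(allP (delta_letters N)); lia.
- have [d [h1 h2 h3]] := IH q qN.
  exists (iota 0 N.+1 ++ d); split.
  + have -> : delta N.+1 = iota 0 N.+1 ++ delta N by [].
    by rewrite h1 iota_shift.
  + have -> : delta N.+1 = iota 0 N.+1 ++ delta N by [].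
    exact/ldiv_cat.
  + have -> : iota 0 N.+1 = iota 0 q ++ q :: q.+1 :: iota q.+2 (N.+1 - q.+2).
      have {1}-> : N.+1 = q + (2 + (N.+1 - q.+2)) by lia.
      by rewrite iotaD add0n iotaD addn2.
    rewrite -catA => /ldiv_far_word[|y [h4 _]]; first by apply: iota_far; lia.
    have a : adj q q.+1 by rewrite /adj eqxx.
    have [z [/cancel_cons h5 _]] := garside_adj a h4.
    have : ldiv [:: q] (iota q.+2 (N.+1 - q.+2) ++ d) by exists z.
    move=> /ldiv_far_word[|y' [h6 _]]; first by apply: iota_far; lia.
    by apply: h3; exists y'.
Qed.

Definition simple N s := ldiv s (delta N).

Lemma simple_ltn N q s : simple N (q :: s) -> q < N.
Proof.
move=> /ldiv_mem/(_ (mem_head _ _)) h; exact: (allP (delta_letters N)) h.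
Qed.

Lemma simple_behead N q s : simple N (q :: s) -> simple N s.
Proof.
move=> h; have [d [h1 h2 _]] := delta_head (simple_ltn h).
apply: ldiv_trans h2; apply/(ldiv_cons q); exact: ldiv_weq h1 h.
Qed.

Lemma simple_catr N x s : simple N (x ++ s) -> simple N s.
Proof. by elim: x => //= i x IH /simple_behead. Qed.

Lemma simple_square N q s : ~ simple N [:: q, q & s].
Proof.
move=> h; have [d [h1 _ h3]] := delta_head (simple_ltn h).
have /ldiv_cons := ldiv_weq (weq_refl _) h1 h; move=> /ldiv1; exact: h3.
Qed.

Lemma simple_letter N q : q < N -> simple N [:: q].
Proof. by move=> /delta_head[d [h _ _]]; exists d. Qed.

(** Both [s] and [q] divide the half twist, hence so does their lcm [q :: s']. *)
Lemma simple_residue1 N q s b : q < N -> simple N s -> ldiv s (q :: b) ->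
  exists s', [/\ simple N (q :: s'), ldiv s' b & ldiv s (q :: s')].
Proof.
move=> qN ss /residue_exists[s' [h1 h2 h3]]; exists s'; split=> //.
have [d [h4 h5 _]] := delta_head qN.
apply: (ldiv_weq (weq_refl _) (weq_sym h4)); apply/ldiv_cons/h3.
exact: ldiv_weq h4 ss.
Qed.

Lemma simple_residue N x s b : all (fun q => q < N) x -> simple N s ->
  ldiv s (x ++ b) -> exists s', [/\ simple N s', ldiv s' b & ldiv s (x ++ s')].
Proof.
elim: x s => [|q x IH] s /=; first by exists s; split=> //; exact: ldiv_refl.
move=> /andP[qN xN] ss /(simple_residue1 qN ss)[s1 [h1 h2 h3]].
have [s' [h4 h5 h6]] := IH _ xN (simple_behead h1) h2.
exists s'; split=> //; apply: ldiv_trans h3 _; exact/ldiv_cons.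
Qed.

(** * Squares and maximal words *)

Lemma letters_bounded (w : seq nat) : exists N, all (fun q => q < N) w.
Proof.
elim: w => [|i w [N h]]; first by exists 0.
exists (maxn i.+1 N); apply/andP; split; first by rewrite leq_max leqnn.
by apply: sub_all h => j; rewrite leq_max orbC => ->.
Qed.

(* The residue of j by x is simple and divides p :: p :: v; each of its left
   letters is p and it contains no square, so it divides [:: p]. *)
Lemma ldiv_square j x p v : (forall q, ldiv [:: q] (p :: v) -> q = p) ->
  ldiv [:: j] (x ++ [:: p, p & v]) -> ldiv [:: j] (x ++ [:: p]).
Proof.
move=> only_p jxp; have [N /= /and3P[jN pN xN]] := letters_bounded [:: j, p & x].
have [s [ss h1 h2]] := simple_residue xN (simple_letter jN) jxp.
apply: ldiv_trans h2 _; apply/ldiv_cat.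
case: s => [|q s] in ss h1 *; first exact: ldiv0.
have qp : q = p.
  have [t /= h] := h1; case: (garside h) => [//|z _ h3 _|z _ h3 _].
    by apply: only_p; exists z.
  by apply: only_p; exists (p :: z).
subst q; apply/ldiv_cons; move/ldiv_cons: h1 => h1.
case: s => [|q s] in ss h1 *; first exact: ldiv0.
by have qp := only_p _ (ldiv1 h1); subst q; case: (simple_square ss).
Qed.

(** Greedy form of lexicographic maximality; [max_lex_repP] proves it equivalent to the original
    definition. *)
Fixpoint maxlex (w : seq nat) : Prop :=
  if w is i :: t then (forall j, ldiv [:: j] w -> j <= i) /\ maxlex t else True.

Lemma maxlex_catr u v : maxlex (u ++ v) -> maxlex v.
Proof. by elim: u => //= i u IH []. Qed.

Lemma maxlex_catl u v : maxlex (u ++ v) -> maxlex u.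
Proof.
elim: u => //= i u IH [h /IH hu]; split=> // j ju; apply: h.
exact: ldiv_trans ju (ldiv_catr (i :: u) v).
Qed.

(** Synchronisation: by [ldiv_square], what follows [p p] adds no left divisor to the suffixes of [u
    ++ [:: p]]. *)
Lemma maxlex_square u p v : (forall q, ldiv [:: q] (p :: v) -> q = p) ->
  maxlex (u ++ [:: p]) -> maxlex (p :: v) -> maxlex (u ++ [:: p, p & v]).
Proof.
move=> only_p + pv; elim: u => [|i u IH] /=.
  move=> _; split=> // j jp.
  have /ldiv_mem := @ldiv_square j [::] p v only_p jp.
  by move=> /(_ _ (mem_head _ _)); rewrite inE => /eqP ->.
move=> [h /IH hu]; split=> // j jp; apply: h.
exact: (@ldiv_square j (i :: u) p v).
Qed.

Lemma maxlex_square_geq u p v : all (fun q => p <= q) v ->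
  maxlex (u ++ [:: p]) -> maxlex (p :: v) -> maxlex (u ++ [:: p, p & v]).
Proof.
move=> pv up pvL; apply: maxlex_square => // q qpv.
have qp : q <= p by case: pvL => h _; exact: h.
have := ldiv_mem qpv (mem_head _ _); rewrite inE => /orP[/eqP //|].
by move=> /(allP pv); lia.
Qed.

Lemma maxlex1 p : maxlex [:: p].
Proof.
split=> // j /ldiv_mem/(_ (mem_head _ _)); by rewrite inE => /eqP ->.
Qed.

Lemma maxlex_double u p : maxlex (u ++ [:: p]) -> maxlex (u ++ [:: p; p]).
Proof. by move=> h; apply: maxlex_square_geq => //; exact: maxlex1. Qed.

Lemma ldiv_adj_letter i j w : adj i j -> ldiv [:: i] (j :: w) ->
  ldiv [:: j; i] (j :: w) /\ ldiv [:: i; j] w.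
Proof.
move=> a [t /= h]; rewrite adjC in a; have [z [h1 h2]] := garside_adj a h.
by split; [apply/ldiv_cons; exists (j :: z) | exists z].
Qed.

(** No relation applies to the two-letter word [p.+1, p], so [p.+1] is its only left divisor and
    gluing at the square applies. *)
Lemma maxlex_descent u p : maxlex (u ++ [:: p.+1; p.+1]) ->
  maxlex (u ++ [:: p.+1; p.+1; p]).
Proof.
have only_p q : ldiv [:: q] [:: p.+1; p] -> q = p.+1.
  move=> h; have := ldiv_mem h (mem_head _ _); rewrite !inE.
  move=> /orP[/eqP //|/eqP e]; subst q.
  have a : adj p p.+1 by rewrite /adj eqxx.
  by have [_ /ldiv_size] := ldiv_adj_letter a h.
move=> h; apply: maxlex_square => //.
  by apply: (@maxlex_catl _ [:: p.+1]); rewrite -catA.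
by split; [move=> q /only_p -> | exact: maxlex1].
Qed.

(** Otherwise [i] and [j] commute, and exchanging them gives a larger word. *)
Lemma maxlex_step u i j v : maxlex (u ++ [:: i, j & v]) -> j <= i.+1.
Proof.
move=> /maxlex_catr[h _]; rewrite leqNgt; apply/negP => ij.
suff : j <= i by lia.
apply: h; exists (i :: v) => /=; apply: weq_far; rewrite /far; lia.
Qed.

(** If [p.+1] divided the word, [p] would have to occur again in [v]; a letter beyond [p.+1] would
    already divide [p.+1 :: v]. *)
Lemma maxlex_cons p v : all (fun q => p < q) v -> maxlex (p.+1 :: v) ->
  maxlex (p :: p.+1 :: v).
Proof.
move=> pv h; split=> // j jp; rewrite leqNgt; apply/negP => pj.
have [jp1|jp1] := eqVneq j p.+1.
  subst j; have a : adj p.+1 p by rewrite /adj eqxx orbT.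
  have [_] := ldiv_adj_letter a jp.
  move=> /ldiv_mem/(_ (_ : p \in _)); rewrite !inE eqxx orbT => /(_ isT).
  by case/orP => [|/(allP pv)]; lia.
have [t /= ht] := jp; have f : far p j by rewrite /far; lia.
have [z [h1 _]] := garside_far f ht.
by case: h => /(_ j (ex_intro _ z h1)); lia.
Qed.

(** * The obstruction to appending 0 *)

(** By induction the letters forced by Garside's lemma already divide [x], so the cofactor is again
    [z1 ++ [:: c]] with [c] absent from [z1]. *)
Lemma parabolic_ldiv (c : nat) (x s : seq nat) : c \notin x -> c \notin s ->
  ldiv s (x ++ [:: c]) -> ldiv s x.
Proof.
elim/ltn_ind: (size x) {-2}x (erefl (size x)) s => l IH {}x sx [|i t].
  by move=> *; exact: ldiv0.
case: x sx => [|k x] sx cx cs.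
  move=> /ldiv_mem/(_ (mem_head _ _)); rewrite inE => /eqP e.
  by move: cs; rewrite inE -e eqxx.
have cik : [/\ c != i, c != k, c \notin x & c \notin t].
  by move: cx cs; rewrite !inE !negb_or => /andP[-> ->] /andP[-> ->].
case: cik => ci ck cx' ct; case=> e /= h.
have sxl : size x < l by rewrite -sx.
case: (letter_cases k i) => ki.
- subst i; apply/ldiv_cons; apply: (IH _ sxl _ erefl) => //.
  by exists e; exact: cancel_cons h.
- have [z [h1 h2]] := garside_far ki h.
  have ci' : c \notin [:: i] by rewrite inE.
  have [z1 h3] := IH _ sxl x erefl [:: i] cx' ci' (ex_intro _ z h1).
  have hz : weq z (z1 ++ [:: c]).
    by apply: (@cancel_cons i); rewrite -h1 h3.
  have cz1 : c \notin z1.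
    apply: contra cx' => h4; by rewrite (weq_mem h3) mem_cat h4 orbT.
  have sz1 : size (k :: z1) < l.
    by have := weq_size h3; rewrite -sx size_cat /=; lia.
  have : ldiv t ((k :: z1) ++ [:: c]) by exists e; rewrite /= -hz -h2.
  move=> /IH -/(_ _ sz1 erefl); rewrite inE negb_or ck cz1 => /(_ isT ct) h4.
  apply: (@ldiv_weq (i :: t) (i :: k :: z1)) => //; last exact/ldiv_cons.
  by rewrite h3 /=; apply: weq_far; rewrite farC.
- have [z [h1 h2]] := garside_adj ki h.
  have cik' : c \notin [:: i; k] by rewrite !inE negb_or ci ck.
  have [z1 h3] := IH _ sxl x erefl [:: i; k] cx' cik' (ex_intro _ z h1).
  have hz : weq z (z1 ++ [:: c]).
    by apply: (@cancel_catl [:: i; k]); rewrite /= -h1 h3.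
  have cz1 : c \notin z1.
    apply: contra cx' => h4; by rewrite (weq_mem h3) mem_cat h4 orbT.
  have sz1 : size (k :: i :: z1) < l.
    by have := weq_size h3; rewrite -sx size_cat /=; lia.
  have : ldiv t ((k :: i :: z1) ++ [:: c]) by exists e; rewrite /= -hz -h2.
  move=> /IH -/(_ _ sz1 erefl).
  rewrite !inE !negb_or ck ci cz1 => /(_ isT ct) h4.
  apply: (@ldiv_weq (i :: t) (i :: k :: i :: z1)) => //; last exact/ldiv_cons.
  by rewrite h3 /=; apply: weq_adj; rewrite adjC.
Qed.

(** Moving 0 to the front past a letter 1 would need another 1 behind it, where only letters at
    least 2 stand. *)
Lemma ldiv_zero_rcons (r : seq nat) : 0 \notin r -> ldiv [:: 0] (r ++ [:: 0]) ->
  all (fun i => 1 < i) r.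
Proof.
elim: r => //= i r IH; rewrite inE negb_or => /andP[i0 r0] [t /= h].
have [i1|i1] := eqVneq i 1; last first.
  have f : far i 0 by rewrite /far; lia.
  have [z [h1 _]] := garside_far f h.
  have r1 : all (fun i => 1 < i) r by apply: IH => //; exists z.
  by rewrite r1; lia.
have a : adj i 0 by rewrite i1.
have [z [h1 _]] := garside_adj a h.
have hr : all (fun i => 1 < i) r by apply: IH => //; exists (i :: z).
have f : all (far 0) r by apply: sub_all hr => j; rewrite /far; lia.
have : weq (0 :: r ++ [::]) (0 :: i :: z) by rewrite weq_far_word.
move=> /cancel_cons; rewrite cats0 => /weq_mem/(_ i); rewrite mem_head.
by move=> /(allP hr); lia.
Qed.

(** After [0 ... k] the next letter is forced: a smaller letter [i] would bring [i.+1] to the front,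
    [k] would make a square, and a letter beyond [k.+1] would commute to the front. *)
Lemma simple_only_zero N t : simple N (0 :: t) ->
  (forall j, ldiv [:: j] (0 :: t) -> j = 0) -> exists m, weq t (iota 1 m).
Proof.
move=> st only0.
suff main k u : weq (0 :: t) (iota 0 k.+1 ++ u) -> exists m, weq t (iota 1 m).
  exact: (main 0 t).
elim: u k => [|i u IH] k h.
  by exists k; apply: (@cancel_cons 0); rewrite h cats0.
have [ik|ik|ik] := ltngtP i k.+1.
- have [ik'|ik'] := eqVneq i k.
    case: (@simple_square N k u); apply: (@simple_catr _ (iota 0 k)).
    apply: (@ldiv_weq (0 :: t)) st => //.
    by rewrite h -addn1 iotaD -catA ik'.
  suff : i.+1 = 0 by [].
  apply: only0; exists (iota 0 k.+1 ++ u).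
  by apply: (weq_trans h); apply: iota_shift; lia.
- suff : i = 0 by lia.
  apply: only0; exists (iota 0 k.+1 ++ u).
  apply: (weq_trans h); apply: weq_sym.
  by apply: (@weq_far_word i (iota 0 k.+1) u); apply: iota_far; lia.
- have e : iota 0 k.+2 = rcons (iota 0 k.+1) k.+1.
    by rewrite -cats1 -[k.+2]addn1 iotaD.
  by subst i; apply: (IH k.+1); rewrite e cat_rcons.
Qed.

Lemma maxlex_rcons_zero u : 0 \notin u -> maxlex u -> maxlex (u ++ [:: 0]).
Proof.
elim: u => [|i u IH]; first by move=> *; exact: maxlex1.
move=> iu0 [h hu]; move: (iu0); rewrite inE negb_or => /andP[i0 u0].
split; last exact: IH.
by case=> [//|j] jiu; apply: h; apply: (@parabolic_ldiv 0 (i :: u) _ iu0 _ jiu).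
Qed.

Lemma last_occurrence (c : nat) (u : seq nat) : c \in u ->
  exists x v, u = x ++ c :: v /\ c \notin v.
Proof.
elim: u => //= i u IH; rewrite inE.
have [/IH [x [v [-> cv]]] _|cu] := boolP (c \in u).
  by exists (i :: x), v.
by rewrite orbF => /eqP <-; exists [::], u.
Qed.

Lemma last_occurrence_inj (c : nat) (x v x' v' : seq nat) :
  x ++ c :: v = x' ++ c :: v' -> c \notin v -> c \notin v' ->
  x = x' /\ v = v'.
Proof.
elim: x x' => [|i x IH] [|i' x'] //=.
- by case=> ->.
- by case=> _ -> /negP[]; rewrite mem_cat mem_head orbT.
- by case=> _ <- _ /negP[]; rewrite mem_cat mem_head orbT.
- by case=> -> /IH h v0 v0'; have [-> ->] := h v0 v0'.
Qed.

(** Let [t] be the residue of [s] by the leading 0. If [t] contained 0, its only left letter would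
    be 1, and 1 could not divide [0 :: t] because [v] contains a 1; then [simple_only_zero] would
    make [t] equivalent to [1 ... m], without 0. So [t] avoids 0 and [parabolic_ldiv] applies. *)
Lemma simple_ldiv_between_zeros N s v : 0 \notin v ->
  maxlex [:: 0, 1 & v] -> ~~ all (fun i => 1 < i) v ->
  simple N s -> 0 < N ->
  ldiv s ([:: 0, 1 & v] ++ [:: 0]) -> ldiv s [:: 0, 1 & v].
Proof.
move=> v0 [max0 max1] nv ss N0 /(simple_residue1 N0 ss)[t [st h1 h2]].
apply: ldiv_trans h2 _; apply/ldiv_cons.
have v0' : 0 \notin 1 :: v by rewrite inE.
have [t0|t0] := boolP (0 \in t); last first.
  exact: (@parabolic_ldiv 0 (1 :: v) _ v0' t0 h1).
have start1 j : ldiv [:: j] t -> j = 1.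
  move=> jt; have [j0|j0] := posnP j.
    case: (jt) => r; rewrite j0 => hr.
    case: (@simple_square N 0 r).
    exact: (ldiv_weq (weq_cons 0 hr) (weq_refl _) st).
  have jv : ldiv [:: j] (1 :: v).
    apply: (@parabolic_ldiv 0 (1 :: v) _ v0' _ (ldiv_trans jt h1)).
    by rewrite inE; lia.
  have [j1|//|//] := ltngtP 1 j; last by lia.
  have [r /= hr] := jv; suff : j <= 0 by lia.
  apply: max0; exists (0 :: r); rewrite hr /=; apply: weq_far; rewrite /far; lia.
suff [m hm] : exists m, weq t (iota 1 m).
  by move: t0; rewrite (weq_mem hm) mem_iota.
apply: (simple_only_zero st) => -[//|j] h.
case: (letter_cases 0 j.+1) => [//|a|a].
  have [e /= he] := h; have [z [hz _]] := garside_far a he.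
  by have := start1 j.+1 (ex_intro _ z hz) => -[j0]; move: a; rewrite j0.
have j0 : j = 0 by move: a; rewrite /adj; lia.
subst j; have [e /= he] := h; have [z [hz _]] := garside_adj a he.
case/negP: nv; apply: ldiv_zero_rcons => //.
apply/(ldiv_cons 1); apply: ldiv_trans h1; by exists z.
Qed.

(** If a letter follows the last 0, it is 1 by [maxlex_step]. If another 1 comes later, residues of
    simple elements show that a final 0 creates no new left divisor. *)
Lemma not_maxlex_rcons_zero u : maxlex u -> ~ maxlex (u ++ [:: 0]) ->
  exists x y, u = x ++ [:: 0, 1 & y] /\ all (fun i => 1 < i) y.
Proof.
move=> hu nu.
have [/last_occurrence[x [v [e v0]]]|u0] := boolP (0 \in u); last first.
  by case: nu; exact: maxlex_rcons_zero.
subst u; exists x.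
case: v v0 hu nu => [|f v] v0 hu nu.
  by case: nu; rewrite -catA; exact: maxlex_double.
have f1 : f <= 1 by exact: maxlex_step hu.
have {}f1 : f = 1 by move: v0; rewrite inE negb_or; lia.
subst f; exists v; split=> //; apply/negPn/negP => nv; apply: nu.
have v0' : 0 \notin v by move: v0; rewrite inE negb_or.
elim: x hu => [|i x IH] hu.
- have h0 := hu; case: hu => h hu; rewrite cat0s; split.
    move=> j hj; apply: h.
    have [N /= /and3P[jN N0 _]] := letters_bounded [:: j; 0].
    exact: simple_ldiv_between_zeros (simple_letter jN) N0 hj.
  exact: (@maxlex_rcons_zero (1 :: v)).
- have h0 : maxlex [:: 0, 1 & v] := @maxlex_catr (i :: x) _ hu.
  case: hu => h hu; split; last exact: IH.
  move=> j hj; apply: h.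
  have [N /= /and4P[jN N0 iN xN]] := letters_bounded [:: j, 0, i & x].
  have hj' : ldiv [:: j] ((i :: x) ++ [:: 0, 1 & v] ++ [:: 0]).
    by move: hj; rewrite /= -catA.
  have [|s [ss s1 s2]] := simple_residue _ (simple_letter jN) hj'.
    by apply/andP.
  apply: ldiv_trans s2 _; apply/(ldiv_cat (i :: x)).
  exact: (simple_ldiv_between_zeros v0' h0 nv ss N0 s1).
Qed.

(** * Prolonging a maximal word down to a given letter *)

Lemma maxlex_nseq u b a : maxlex (u ++ [:: b]) -> maxlex (u ++ nseq a.+1 b).
Proof.
move=> h; elim: a => // a IH.
have e k : nseq k.+1 b = nseq k b ++ [:: b] by rewrite -[k.+1]addn1 nseqD.
rewrite (e a.+1) (e a) -!catA catA; apply: maxlex_double.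
by rewrite -catA -e.
Qed.

Lemma maxlex_reach u p b : p < b -> maxlex (u ++ [:: b]) ->
  exists s, [/\ size s = (2 * (b - p)).-1, all (fun i => p < i <= b) s &
    maxlex (u ++ [:: b] ++ s ++ [:: p])].
Proof.
elim: b u => // b IH u pb /maxlex_double/maxlex_descent h.
have [pb'|bp] := ltnP p b; last first.
  have {bp}e : p = b by lia.
  by subst p; exists [:: b.+1]; split=> //=; lia.
have [|s [h1 h2 h3]] := IH (u ++ [:: b.+1; b.+1]) pb'.
  by rewrite -catA.
exists [:: b.+1, b & s]; split=> /=.
- by rewrite h1; lia.
- rewrite pb pb' leqnn leqnSn /=.
  by apply: sub_all h2 => i /andP[-> ib]; rewrite (leq_trans ib) ?leqnSn.
- by move: h3; rewrite -!catA.
Qed.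

Lemma maxlex_reach_exact u p b m : p < b -> 2 * (b - p) <= m ->
  maxlex (u ++ [:: b]) ->
  exists s, [/\ size s = m.-1, all (fun i => p < i <= b) s &
    maxlex (u ++ [:: b] ++ s ++ [:: p])].
Proof.
(* The surplus length is spent on repeating [b]. *)
move=> pb hm /maxlex_nseq -/(_ (m - 2 * (b - p))); set a := m - _ => h.
have [|s [h1 h2 h3]] := @maxlex_reach (u ++ nseq a b) p b pb.
  by move: h; rewrite -[a.+1]addn1 nseqD catA.
exists (nseq a b ++ s); split.
- by rewrite size_cat size_nseq h1 /a; lia.
- by rewrite all_cat h2 all_nseq pb leqnn orbT.
- move: h3; rewrite -!catA; congr (maxlex (_ ++ _)).
  by rewrite catA -[[:: b]]/(nseq 1 b) -nseqD addn1.
Qed.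

(** * Lowering the letters after the last 0 *)

Lemma weq_shift w w' : weq w w' -> weq (map S w) (map S w').
Proof.
elim=> {w w'} /= [i j w h|i j w h|i w w' _|w|w w' _|w1 w2 w3 _ h1 _].
- exact: weq_far.
- exact: weq_adj.
- exact: weq_cons.
- exact: weq_refl.
- exact: weq_sym.
- exact: weq_trans.
Qed.

Lemma maxlex_unshift w : maxlex (map S w) -> maxlex w.
Proof.
elim: w => //= i w IH [h /IH hw]; split=> // j [t /weq_shift /= ht].
by rewrite -ltnS; apply: h; exists (map S t).
Qed.

(** The suffix from 2 on is the shift of [1 :: y], which is therefore maximal and is glued at the
    square [1 1]. The second 1 then rules out the obstruction to appending 0. *)
Lemma maxlex_lower x y : all (fun i => 0 < i) y ->
  maxlex (x ++ [:: 0, 1, 2 & map S y]) -> maxlex (x ++ [:: 0, 1, 1 & y] ++ [:: 0]).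
Proof.
move=> y0 h.
have y0' : 0 \notin y by apply/negP => /(allP y0).
have hy : maxlex (x ++ [:: 0, 1, 1 & y]).
  have := @maxlex_square_geq (x ++ [:: 0]) 1 y y0; rewrite -!catA; apply.
    by apply: (@maxlex_catl _ [:: 2 & map S y]); rewrite -catA.
  apply: maxlex_unshift; apply: (@maxlex_catr (x ++ [:: 0; 1])).
  by rewrite -catA.
have [//|] := pselect (maxlex (x ++ [:: 0, 1, 1 & y] ++ [:: 0])).
rewrite catA => /(not_maxlex_rcons_zero hy)[x' [y' [e h']]].
have [||_ [e2]] := last_occurrence_inj e.
- by rewrite !inE.
- by rewrite inE; apply/negP => /(allP h').
by move: h'; rewrite -e2.
Qed.

Lemma maxlex_lower_nil x : maxlex (x ++ [:: 0; 1]) ->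
  maxlex (x ++ [:: 0; 0] ++ [:: 0]).
Proof.
move=> h; apply: (@maxlex_nseq x 0 2).
by apply: (@maxlex_catl _ [:: 1]); rewrite -catA.
Qed.

Import Order.TTheory GRing.Theory Num.Theory.
Import numFieldNormedType.Exports.
Local Open Scope ring_scope.

(** * Counting maximal words by extension *)

Section Counting.
Variables (R : realFieldType) (n : nat).
Implicit Types (f g : seq nat -> R) (p k l : nat) (u v w : seq nat).

Definition in_range p (j : nat) := (p <= j < n)%N.

(** A transfer operator on functions of words: cutting prolongations at a position becomes
    composition of iterates ([extensionsD]). *)
Definition extend p f w : R := \sum_(p <= j < n) f (rcons w j).

Definition extensions p k f : seq nat -> R := iter k (extend p) f.
Arguments extensions : simpl never.

Lemma extensionsS p k f w :
  extensions p k.+1 f w = \sum_(p <= j < n) extensions p k f (rcons w j).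
Proof. by []. Qed.

Lemma extensionsD p k l f :
  extensions p (k + l) f = extensions p k (extensions p l f).
Proof. exact: iterD. Qed.

Lemma le_extensions p k f g u w :
  (forall v, size v = k -> all (in_range p) v -> f (u ++ v) <= g (w ++ v)) ->
  extensions p k f u <= extensions p k g w.
Proof.
elim: k u w => [|k IH] u w fg.
  by have := fg [::]; rewrite !cats0; exact.
apply: ler_sum_nat => j pj; apply: IH => v vk vp.
by rewrite !cat_rcons; apply: fg => /=; [rewrite vk | rewrite /in_range pj].
Qed.

Lemma extensions_ge0 p k f w :
  (forall v, all (in_range p) v -> 0 <= f (w ++ v)) -> 0 <= extensions p k f w.
Proof.
elim: k w => [|k IH] w f0; first by have := f0 [::]; rewrite cats0; exact.
rewrite extensionsS big_nat; apply: sumr_ge0 => j pj; apply: IH => v vp.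
by rewrite cat_rcons; apply: f0; rewrite /= /in_range pj.
Qed.

Lemma extensions_term p f w v :
  (forall v, all (in_range p) v -> 0 <= f (w ++ v)) -> all (in_range p) v ->
  f (w ++ v) <= extensions p (size v) f w.
Proof.
elim: v w => [|j v IH] w f0 /=; first by rewrite cats0.
move=> /andP[pj vp].
have f0' i : (p <= i < n)%N ->
    forall v, all (in_range p) v -> 0 <= f (rcons w i ++ v).
  by move=> pi v' v'p; rewrite cat_rcons; apply: f0; rewrite /= /in_range pi.
apply: (@le_trans _ _ (extensions p (size v) f (rcons w j))).
  by rewrite -cat_rcons; apply: IH => //; exact: f0'.
have jr : j \in index_iota p n by rewrite mem_index_iota.
rewrite extensionsS (big_rem j) //= lerDl big_seq.
apply: sumr_ge0 => i /mem_rem; rewrite mem_index_iota => /f0'.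
exact: extensions_ge0.
Qed.

Lemma extensions_lin p k f g (a b : R) w :
  extensions p k (fun w => a * f w + b * g w) w =
  a * extensions p k f w + b * extensions p k g w.
Proof.
elim: k w => // k IH w; rewrite !extensionsS !mulr_sumr -big_split /=.
by apply: eq_bigr => j _; exact: IH.
Qed.

Definition chi w : R := (`[< maxlex w >] : bool)%:R.

Lemma chi_ge0 w : 0 <= chi w. Proof. exact: ler0n. Qed.
Lemma chi_le1 w : chi w <= 1. Proof. by rewrite /chi; case: asbool; rewrite ?ler01. Qed.
#[local] Hint Resolve chi_ge0 chi_le1 : core.

Lemma chi_le w w' : (maxlex w -> maxlex w') -> chi w <= chi w'.
Proof.
move=> h; rewrite /chi; case: asboolP => // mw.
by rewrite (asboolT (h mw)).
Qed.

Lemma chi1 w : maxlex w -> chi w = 1.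
Proof. by move=> h; rewrite /chi asboolT. Qed.

Lemma chi0 w : ~ maxlex w -> chi w = 0.
Proof. by move=> h; rewrite /chi asboolF. Qed.

Lemma extensions_chi_catl p k u w :
  extensions p k chi (u ++ w) <= extensions p k chi w.
Proof.
by apply: le_extensions => v _ _; rewrite -catA; apply: chi_le; exact: maxlex_catr.
Qed.

Lemma extensions_chi_le p k w :
  extensions p k chi w <= chi w * (n - p)%:R ^+ k.
Proof.
elim: k w => [|k IH] w; first by rewrite expr0 mulr1.
rewrite extensionsS.
apply: (@le_trans _ _ (\sum_(p <= j < n) chi w * (n - p)%:R ^+ k)).
  apply: ler_sum_nat => j _; apply: le_trans (IH _) _.
  rewrite ler_wpM2r ?exprn_ge0 ?ler0n //.
  by apply: chi_le; rewrite -cats1; exact: maxlex_catl.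
by rewrite sumr_const_nat exprSr mulrA mulr_natr.
Qed.

Lemma extensions_chiS_le p k w :
  extensions p k.+1 chi w <= (n - p)%:R * extensions p k chi w.
Proof.
have -> : (n - p)%:R * extensions p k chi w =
   extensions p k (fun w => (n - p)%:R * chi w + 0 * chi w) w.
  by rewrite extensions_lin mul0r addr0.
rewrite -addn1 extensionsD; apply: le_extensions => v _ _.
by have := extensions_chi_le p 1 (w ++ v); rewrite expr1 mulrC mul0r addr0.
Qed.

(** * Domination by words starting with their least letter *)

Definition words p k := extensions p k chi [::].

(** The value 1 at length 0 accounts, in [extensions_split_le], for words in which [p] does not
    occur. *)
Definition headed_words p k := if k is l.+1 then extensions p l chi [:: p] else 1.

Lemma headed_words_ge1 p k : (p < n)%N -> 1 <= headed_words p k.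
Proof.
case: k => // k pn /=.
have <- : chi (p :: nseq k p) = 1.
  by apply: chi1; exact: (@maxlex_nseq [::] p k (maxlex1 p)).
rewrite -{2}(size_nseq k p) -cat1s; apply: extensions_term => //.
by apply/allP => j; rewrite mem_nseq /in_range => /andP[_ /eqP ->]; rewrite leqnn.
Qed.

Lemma headed_words_ge0 p k : (p < n)%N -> 0 <= headed_words p k.
Proof. by move=> /(headed_words_ge1 k); apply: le_trans. Qed.

Lemma headed_wordsS_le p k : (p < n)%N ->
  headed_words p k.+1 <= n%:R * headed_words p k.
Proof.
case: k => [|k] pn /=.
  apply: le_trans (chi_le1 _) _; rewrite mulr1 ler1n; lia.
apply: le_trans (extensions_chiS_le _ _ _) _.
rewrite ler_wpM2r ?extensions_ge0 // ler_nat; lia.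
Qed.

Lemma headed_words_addn_le p k l : (p < n)%N ->
  headed_words p (k + l) <= n%:R ^+ l * headed_words p k.
Proof.
move=> pn; elim: l => [|l IH]; first by rewrite addn0 expr0 mul1r.
rewrite addnS; apply: le_trans (headed_wordsS_le _ pn) _.
by rewrite exprS -mulrA ler_wpM2l ?ler0n.
Qed.

(** Cut at the first [p] appended to [w]; both pieces of a maximal word are maximal. *)
Lemma extensions_split_le p k w : (p < n)%N ->
  extensions p k chi w <=
    \sum_(0 <= i < k.+1) extensions p.+1 i chi w * headed_words p (k - i).
Proof.
move=> pn; elim: k w => [|k IH] w; first by rewrite big_nat1 mulr1.
rewrite extensionsS big_ltn // big_nat_recl // subn0.
apply: lerD.
  have [mw|mw] := pselect (maxlex w).
    rewrite [X in X * _]chi1 // mul1r -cats1; exact: extensions_chi_catl.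
  rewrite [X in X * _]chi0 // mul0r; apply: le_trans (extensions_chi_le _ _ _) _.
  rewrite chi0 ?mul0r // => h; apply: mw; apply: (@maxlex_catl _ [:: p]).
  by rewrite cats1.
rewrite (eq_big_nat _ _ (F2 := fun i => \sum_(p.+1 <= j < n)
    extensions p.+1 i chi (rcons w j) * headed_words p (k - i))); last first.
  by move=> i _; rewrite subSS extensionsS mulr_suml.
by rewrite exchange_big_nat /=; apply: ler_sum => j _; exact: IH.
Qed.

(* The first p marks the position of a cut, so that concatenations cut at
   different positions stay distinct in [marked_split_le]. *)
Definition marked p k l :=
  extensions p.+1 k (fun w => extensions p l chi (rcons w p)).

Lemma marked_split_le p k w : (p < n)%N ->
  \sum_(0 <= a < k) marked p a (k - a.+1) w <= extensions p k chi w.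
Proof.
move=> pn; elim: k w => [|k IH] w; first by rewrite big_geq // chi_ge0.
rewrite extensionsS [X in _ <= X]big_ltn // big_nat_recl //.
rewrite subSS subn0; apply: lerD => //.
rewrite (eq_big_nat _ _ (F2 := fun a => \sum_(p.+1 <= j < n)
    marked p a (k - a.+1) (rcons w j))); last by move=> i _; rewrite subSS.
by rewrite exchange_big_nat /=; apply: ler_sum => j _; exact: IH.
Qed.

(** Repeat the final [p] and glue at the resulting square. *)
Lemma headed_words_rcons p k w s : (p < n)%N -> maxlex (w ++ rcons s p) ->
  headed_words p k <= extensions p k chi (w ++ rcons s p).
Proof.
move=> pn h; case: k => [|k] /=; first by rewrite [extensions _ _ _ _]chi1.
apply: (@le_trans _ _ (extensions p k chi (w ++ rcons s p ++ [:: p]))); last first.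
  rewrite extensionsS big_ltn // -!cats1 -!catA lerDl.
  by apply: sumr_ge0 => j _; exact: extensions_ge0.
apply: le_extensions => v _ vp; apply: chi_le => hv.
rewrite -cats1 -!catA /= catA; apply: maxlex_square_geq => //.
  by apply: sub_all vp => j /andP[].
by rewrite -catA cats1.
Qed.

(** A word starting with [p.+1] is put after [p], then led back to [p] by a bridge of letters above
    [p], and the second word is glued there. *)
Lemma marked_ge p i k : (p.+1 < n)%N ->
  headed_words p.+1 i.+1 * headed_words p k <=
  marked p (i.+1 + (2 * n).-1) k [:: p].
Proof.
move=> pn; rewrite /marked extensionsD extensionsS big_ltn //.
apply: ler_wpDr.
  by apply: sumr_ge0 => j _; do 3! apply: extensions_ge0 => ? _ //.
rewrite mulrC [headed_words p.+1 _]/=.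
have -> : headed_words p k * extensions p.+1 i chi [:: p.+1] =
   extensions p.+1 i (fun w => headed_words p k * chi w + 0 * chi w) [:: p.+1].
  by rewrite extensions_lin mul0r addr0.
apply: le_extensions => v _ vp; rewrite mul0r addr0.
have [hv|hv] := pselect (maxlex ([:: p.+1] ++ v)); last first.
  by rewrite chi0 // mulr0; do 2! apply: extensions_ge0 => ? _ //.
rewrite chi1 // mulr1.
have vp' : all (fun j => p < j)%N v by apply: sub_all vp => j /andP[].
have hw : maxlex (p :: p.+1 :: v) by exact: maxlex_cons.
have [u [b [e pb bn]]] : exists u b,
    [/\ p :: p.+1 :: v = u ++ [:: b], (p < b)%N & (b < n)%N].
  exists (p :: belast p.+1 v), (last p.+1 v); split.
  - by rewrite /= cats1 -lastI.
  - by have := mem_last p.+1 v; rewrite inE => /orP[/eqP -> //|/(allP vp')].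
  - have := mem_last p.+1 v; rewrite inE => /orP[/eqP -> //|/(allP vp)].
    by case/andP.
rewrite -[rcons _ _ ++ v]/(p :: p.+1 :: v) e.
rewrite e in hw.
(* The bound [2 * n] serves every [b], so the bridge length does not depend on the word. *)
have [|s [hs hs1 hs2]] := @maxlex_reach_exact u p b (2 * n) pb _ hw; first by lia.
rewrite -hs.
have sp : all (in_range p.+1) s.
  by apply: sub_all hs1 => j; rewrite /in_range; lia.
apply: (le_trans _ (@extensions_term p.+1 _ (u ++ [:: b]) s _ sp)); last first.
  by move=> ? _; exact: extensions_ge0.
rewrite -catA rcons_cat; apply: headed_words_rcons; first by lia.
by rewrite -cats1; move: hs2; rewrite -!catA.
Qed.

Lemma marked_ge0 p k l w : 0 <= marked p k l w.
Proof. by do 2! apply: extensions_ge0 => ? _ //. Qed.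

Lemma headed_words_conv p k : (p.+1 < n)%N ->
  \sum_(0 <= i < k) headed_words p.+1 i.+1 * headed_words p (k - i.+1) <=
  headed_words p (k + 2 * n).+1.
Proof.
move=> pn; rewrite [headed_words p _.+1]/=.
apply: le_trans (marked_split_le _ _ (ltnW pn)).
(* Cuts before [2 * n] are discarded; the cut [i + 2 * n] leaves room for a block of length [i.+1]
   and a bridge of length [2 * n - 1]. *)
rewrite [X in _ <= X](@big_cat_nat _ _ _ (2 * n)) ?leq_addl //=.
apply: ler_wpDl; first by apply: sumr_ge0 => a _; exact: marked_ge0.
rewrite [X in _ <= X](_ : _ = \sum_(0 <= i < k)
    marked p (i + 2 * n) (k + 2 * n - (i + 2 * n).+1) [:: p]); last first.
  by rewrite -{1}[(2 * n)%N]add0n big_addn addnK.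
apply: ler_sum_nat => i ik.
have := marked_ge i (k - i.+1) pn.
have -> : (i.+1 + (2 * n).-1 = i + 2 * n)%N by lia.
by have -> : (k + 2 * n - (i + 2 * n).+1 = k - i.+1)%N by lia.
Qed.

(** Descending induction on [p]: split at the first [p], dominate the part before it by words
    starting with [p.+1], and reassemble by [headed_words_conv]. The [2 * n + 1] extra letters cost
    a power of [n]. *)
Lemma words_le_headed p : (p < n)%N ->
  exists2 C : R, 0 <= C & forall k, words p k <= C * headed_words p k.
Proof.
have [d] := ubnP (n - p); elim: d p => // d IH p dn pn.
have [pn'|np] := ltnP p.+1 n; last first.
  exists 1 => // k; rewrite mul1r; apply: le_trans (headed_words_ge1 _ pn).
  apply: le_trans (extensions_chi_le _ _ _) _.
  have -> : (n - p = 1)%N by lia.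
  by rewrite expr1n mulr1.
have [||C C0 hC] := IH p.+1 => //; first by lia.
exists (1 + C * n%:R ^+ (2 * n).+1).
  by rewrite addr_ge0 // mulr_ge0 // exprn_ge0.
move=> k; apply: le_trans (extensions_split_le _ _ pn) _.
rewrite big_nat_recl // subn0 mulrDl mul1r; apply: lerD.
  by rewrite ler_piMl ?headed_words_ge0 ?chi_le1.
rewrite -mulrA.
apply: (@le_trans _ _ (C * headed_words p (k + (2 * n).+1))); last first.
  by rewrite ler_wpM2l ?headed_words_addn_le.
rewrite addnS.
apply: le_trans (ler_wpM2l C0 (headed_words_conv _ pn')).
rewrite mulr_sumr; apply: ler_sum_nat => i ik.
by rewrite mulrA ler_wpM2r ?headed_words_ge0 //; exact: (hC i.+1).
Qed.

(** * A growth rate below 4 *)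

(* The weight 2^j (2 f(j+1) - f(j)), for the strictly concave f below, is a
   supersolution of the transfer inequality coming from [maxlex_step]; its
   eigenvalue would be 4 for the linear function f, and concavity lowers it. *)
Let f (j : nat) : R := j%:R * (2 * n%:R + 4 - j%:R).
Let weight (j : nat) : R := 2 ^+ j * (2 * f j.+1 - f j).
Let M : R := (n + 2)%:R ^+ 2.
(** The ratio at [i] is [4 * f i.+2 / (f i.+2 + 2)], increasing in [f i.+2], and [M] is the maximum
    of [f], reached at [n + 2]. *)
Definition growth_bound : R := 4 * M / (M + 2).

Let M_ge4 : 4 <= M.
Proof. rewrite /M natrD; have : 0 <= n%:R :> R by []; nra. Qed.

Lemma growth_bound_lt4 : growth_bound < 4.
Proof. rewrite /growth_bound ltr_pdivrMr; have := M_ge4; lra. Qed.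

Lemma growth_bound_ge1 : 1 <= growth_bound.
Proof. rewrite /growth_bound ler_pdivlMr; have := M_ge4; lra. Qed.

(** The second difference of [f] is -2. *)
Let weightE j : weight j = 2 ^+ j * (f j.+2 + 2).
Proof. by rewrite /weight /f -!natr1; ring. Qed.

Let f_ge0 j : (j <= n + 2)%N -> 0 <= f j.
Proof.
move=> jn; rewrite /f mulr_ge0 ?ler0n // subr_ge0.
have : j%:R <= (n + 2)%:R :> R by rewrite ler_nat.
by rewrite natrD; have : 0 <= n%:R :> R by []; lra.
Qed.

Let f_leM j : f j <= M.
Proof.
rewrite /f /M natrD; set x : R := j%:R; set y : R := n%:R.
by have := sqr_ge0 (x - (y + 2)); rewrite !expr2; lra.
Qed.

Let weight_ge1 j : (j <= n)%N -> 1 <= weight j.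
Proof.
move=> jn; rewrite weightE.
have h : 0 <= f j.+2 by apply: f_ge0; lia.
have h2 : 1 <= 2 ^+ j :> R by rewrite exprn_ege1 // ler1n.
nra.
Qed.

(** Telescoping: [weight j] is the increment of [2 ^+ j * f j]. *)
Let sum_weight k : \sum_(0 <= j < k) weight j = 2 ^+ k * f k.
Proof.
elim: k => [|k IH]; first by rewrite big_geq // /f mul0r mulr0.
by rewrite big_nat_recr //= IH /weight exprS; ring.
Qed.

Let sum_weight_le i : (i < n)%N ->
  \sum_(0 <= j < n) (j <= i.+1)%:R * weight j <= growth_bound * weight i.
Proof.
move=> lt_in.
have h1 : \sum_(0 <= j < n) (j <= i.+1)%:R * weight j <= 2 ^+ i.+2 * f i.+2.
  rewrite -sum_weight; apply: (@le_trans _ _ (\sum_(0 <= j < minn n i.+2) weight j)).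
    rewrite (@big_cat_nat _ _ _ (minn n i.+2)) ?geq_minl //=.
    rewrite [X in _ + X]big_nat [X in _ + X]big1 ?addr0; last first.
      move=> j hj; have -> : (j <= i.+1)%N = false by lia.
      by rewrite mul0r.
    apply: ler_sum_nat => j hj; rewrite ler_piMl ?lern1 //; last first.
      by case: (j <= i.+1)%N.
    by apply: le_trans (weight_ge1 _) => //; lia.
  (* The index [i.+1] may equal [n], so positivity of the weight is needed at [n] too. *)
  rewrite [X in _ <= X](@big_cat_nat _ _ _ (minn n i.+2)) ?geq_minr //=.
  rewrite lerDl big_nat; apply: sumr_ge0 => j hj.
  by apply: le_trans (weight_ge1 _) => //; lia.
apply: le_trans h1 _.
have -> : 2 ^+ i.+2 * f i.+2 = 2 ^+ i * (4 * f i.+2) by rewrite !exprS; ring.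
rewrite weightE [leRHS]mulrCA ler_wpM2l ?exprn_ge0 //.
rewrite /growth_bound mulrAC ler_pdivlMr; last by have := M_ge4; lra.
have := f_leM i.+2; nra.
Qed.

Let weighted w := chi w * weight (last 0%N w).

Let extend_weighted w i : (i < n)%N ->
  extend 0 weighted (rcons w i) <= growth_bound * weighted (rcons w i).
Proof.
move=> lt_in; rewrite /weighted last_rcons mulrCA.
apply: le_trans (ler_wpM2l (chi_ge0 _) (sum_weight_le lt_in)).
rewrite mulr_sumr; apply: ler_sum_nat => j jn.
rewrite /weighted /= last_rcons [leRHS]mulrA ler_wpM2r //.
  by apply: le_trans (weight_ge1 _) => //; lia.
have [h|h] := pselect (maxlex (rcons (rcons w i) j)); last first.
  by rewrite chi0 // mulr_ge0.
have -> : (j <= i.+1)%N.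
  by move: h; rewrite -!cats1 -catA; exact: maxlex_step.
by rewrite mulr1; apply: chi_le; rewrite -cats1; exact: maxlex_catl.
Qed.

Let extensions_weighted k w i : (i < n)%N ->
  extensions 0 k weighted (rcons w i) <= growth_bound ^+ k * weighted (rcons w i).
Proof.
have g0 : 0 <= growth_bound by apply: le_trans growth_bound_ge1.
elim: k w i => [|k IH] w i lt_in; first by rewrite expr0 mul1r.
rewrite extensionsS exprSr -mulrA.
apply: le_trans (ler_wpM2l (exprn_ge0 k g0) (extend_weighted w lt_in)).
by rewrite mulr_sumr; apply: ler_sum_nat => j /andP[_ jn]; exact: IH.
Qed.

Lemma words_growth : exists C, forall k, words 0 k <= C * growth_bound ^+ k.
Proof.
exists (1 + \sum_(0 <= j < n) weight j) => k.
have g1 := growth_bound_ge1.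
have w0 : 0 <= \sum_(0 <= j < n) weight j.
  rewrite big_nat; apply: sumr_ge0 => j hj.
  by apply: le_trans (weight_ge1 _) => //; lia.
case: k => [|k].
  by rewrite expr0 mulr1; apply: le_trans (chi_le1 _) _; rewrite lerDl.
apply: (@le_trans _ _ ((\sum_(0 <= j < n) weight j) * growth_bound ^+ k)); last first.
  have h1 : 1 <= growth_bound ^+ k by exact: exprn_ege1.
  have h0 : 0 <= growth_bound ^+ k by apply: le_trans h1.
  by rewrite exprS ler_pM // ?lerDr // ler_peMl.
rewrite /words extensionsS mulr_suml; apply: ler_sum_nat => j /andP[_ jn].
rewrite mulrC; apply: (@le_trans _ _ (extensions 0 k weighted (rcons [::] j))).
  apply: le_extensions => v _ vn; rewrite /weighted ler_peMr //.
  apply: weight_ge1; apply: ltnW; rewrite last_cat /=.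
  by have := mem_last j v; rewrite inE => /orP[/eqP -> //|/(allP vn)].
apply: le_trans (extensions_weighted _ _ jn) _.
rewrite ler_wpM2l ?exprn_ge0 //; first by apply: le_trans g1.
by rewrite /weighted ler_piMl //; apply: le_trans (weight_ge1 (ltnW jn)).
Qed.

(** * Convergence by contraction *)

(** The default 1 makes the empty word count as not ending in 0. *)
Definition chi_end w : R := (`[< maxlex w >] && (last 1%N w == 0%N))%:R.

Lemma chi_end_ge0 w : 0 <= chi_end w. Proof. exact: ler0n. Qed.

Lemma chi_end_le_chi w : chi_end w <= chi w.
Proof. by rewrite /chi_end /chi ler_nat; case: asboolP => _; rewrite ?leq_b1. Qed.

(** The contraction needs one length for all [w]: [2 * n] letters to reach 0, one more to double
    it. *)
Lemma synchronize w : (0 < n)%N -> all (in_range 0) w -> maxlex w ->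
  exists s, [/\ size s = (2 * n).+1, all (in_range 0) s &
    exists u, w ++ s = u ++ [:: 0%N; 0%N] /\ maxlex (w ++ s)].
Proof.
move=> n0 wn hw.
suff [s [s1 s2 [u [s3 s4]]]] : exists s, [/\ size s = (2 * n)%N,
    all (in_range 0) s & exists u, w ++ s = u ++ [:: 0%N] /\ maxlex (w ++ s)].
  exists (rcons s 0%N); split.
  - by rewrite size_rcons s1.
  - by rewrite all_rcons s2 /in_range n0.
  - exists u; rewrite -cats1 catA s3 -catA; split=> //.
    by apply: maxlex_double; rewrite -s3.
have zeros u : maxlex (rcons u 0%N) -> exists s, [/\ size s = (2 * n)%N,
    all (in_range 0) s & exists u', u ++ s = u' ++ [:: 0%N] /\ maxlex (u ++ s)].
  move=> hu; exists (nseq (2 * n) 0%N); split.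
  - by rewrite size_nseq.
  - by rewrite all_nseq /in_range n0 orbT.
  have -> : (2 * n = (2 * n).-1 + 1)%N by lia.
  exists (u ++ nseq (2 * n).-1 0%N); rewrite -catA nseqD; split=> //.
  by rewrite -nseqD addn1; apply: maxlex_nseq; rewrite cats1.
case/lastP: w wn hw => [|w b] wn hw; first exact: (zeros [::] (maxlex1 0)).
have [b0|b0] := posnP b.
  by apply: zeros; subst b; rewrite -!cats1 -catA; apply: maxlex_double; rewrite cats1.
have bn : (b < n)%N by move: wn; rewrite all_rcons => /andP[].
rewrite -cats1 in hw.
have [|s [s1 s2 s3]] := @maxlex_reach_exact w 0 b (2 * n) b0 _ hw; first by lia.
exists (rcons s 0%N); split.
- by rewrite size_rcons s1; lia.
- rewrite all_rcons /in_range n0; apply: sub_all s2 => j /=; lia.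
- by exists (w ++ [:: b] ++ s); move: s3; rewrite -!cats1 -!catA.
Qed.

(** Gluing at the square gives [u 0 0] the same continuations as a single 0: the past is
    forgotten. *)
Lemma extensions_restart l u g : g = chi \/ g = chi_end ->
  maxlex (u ++ [:: 0; 0]%N) ->
  extensions 0 l g (u ++ [:: 0; 0]%N) = extensions 0 l g [:: 0%N].
Proof.
move=> hg hu.
have h v : maxlex ((u ++ [:: 0; 0]%N) ++ v) <-> maxlex ([:: 0%N] ++ v).
  split=> [|hv].
    have -> : (u ++ [:: 0; 0]%N) ++ v = (u ++ [:: 0%N]) ++ [:: 0%N] ++ v.
      by rewrite -!catA.
    exact: maxlex_catr.
  rewrite -catA; apply: maxlex_square_geq => //; first by apply/allP.
  by apply: (@maxlex_catl _ [:: 0%N]); rewrite -catA.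
have e v : g ((u ++ [:: 0; 0]%N) ++ v) = g ([:: 0%N] ++ v).
  by case: hg => ->; rewrite /chi /chi_end ?last_cat (asbool_equiv_eq (h v)).
by apply/eqP; rewrite eq_le; apply/andP; split; apply: le_extensions => v _ _;
  rewrite e.
Qed.

(** Products instead of quotients include the non-maximal [w], for which both sums vanish. *)
Definition bracketed (a b : R) l := forall w, all (in_range 0) w ->
  a * extensions 0 l chi w <= extensions 0 l chi_end w <= b * extensions 0 l chi w.

Lemma bracketed0 : bracketed 0 1 0.
Proof. by move=> w _; rewrite mul0r mul1r chi_end_ge0 chi_end_le_chi. Qed.

Lemma bracketedD a b l k : bracketed a b l -> bracketed a b (l + k).
Proof.
move=> h; elim: k => [|k IH] w wn; first by rewrite addn0; exact: h.
rewrite addnS !extensionsS !mulr_sumr.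
have hw j : (0 <= j < n)%N -> all (in_range 0) (rcons w j).
  by move=> jn; rewrite all_rcons /in_range jn.
by apply/andP; split; apply: ler_sum_nat => j /hw/IH/andP[].
Qed.

Lemma words_le_restart : (0 < n)%N ->
  exists2 D : R, 1 <= D & forall l w,
    extensions 0 (l + (2 * n).+1) chi w <= D * extensions 0 l chi [:: 0%N].
Proof.
move=> n0; have [C C0 hC] := words_le_headed n0.
(* Passing from length [l.+1] to [l + 2 * n + 1] costs [n ^ (2 * n)]; the summand 1 secures
   [1 <= D]. *)
exists (1 + n%:R ^+ (2 * n) * C).
  by rewrite lerDl mulr_ge0 // exprn_ge0.
move=> l w; have := extensions_chi_catl 0 (l + (2 * n).+1) w [::].
rewrite cats0 => /le_trans; apply.
apply: le_trans (hC _) _.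
rewrite addnS -addSn; apply: le_trans (ler_wpM2l C0 (headed_words_addn_le _ _ n0)) _.
rewrite mulrCA mulrA mulrDl [headed_words _ _]/= lerDr mul1r.
exact: extensions_ge0.
Qed.

(* Doeblin's argument: each word can be synchronised within 2n+1 letters, after
   which a fixed fraction of its extensions has the same statistics. *)
Lemma bracketed_contraction : (0 < n)%N -> exists q : R, [/\ 0 <= q, q < 1 &
  forall a b l, a <= b -> bracketed a b l -> exists a' b',
    [/\ a' <= b', b' - a' <= q * (b - a) & bracketed a' b' (l + (2 * n).+1)]].
Proof.
move=> n0; have [D D1 hD] := words_le_restart n0.
have D0 : 0 < D by lra.
exists (1 - D^-1); split.
- by rewrite subr_ge0 invf_le1.
- by rewrite ltrBlDr ltrDl invr_gt0.
move=> a b l ab h.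
set c := extensions 0 l chi [:: 0%N]; set e := extensions 0 l chi_end [:: 0%N].
have c1 : 1 <= c := headed_words_ge1 l.+1 n0.
have c0 : 0 < c by lra.
have rn : all (in_range 0) [:: 0%N] by rewrite /= /in_range n0.
have /andP[] := h _ rn; rewrite -/c -/e => ac bc.
have cc : c / c = 1 by rewrite divff // gt_eqF.
set d := D^-1; have d0 : 0 < d by rewrite invr_gt0.
have Dd : D * d = 1 by rewrite divff // gt_eqF.
set r := e / c; have er : e = r * c by rewrite mulfVK // gt_eqF.
have ar : a <= r by rewrite ler_pdivlMr.
have rb : r <= b by rewrite ler_pdivrMr.
(* Both ends move towards the ratio [r] after a restart by the fraction [d = 1 / D], so the gap
   shrinks by the factor [1 - d]. *)
exists (a + d * (r - a)), (b - d * (b - r)); split.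
- have : d <= 1 by rewrite invf_le1.
  nra.
- by rewrite -/d; lra.
move=> w wn.
have [hw|hw] := pselect (maxlex w); last first.
  have z : extensions 0 (l + (2 * n).+1) chi w = 0.
    apply/eqP; rewrite eq_le extensions_ge0 // andbT.
    by apply: le_trans (extensions_chi_le _ _ _) _; rewrite chi0 // mul0r.
  have z' : extensions 0 (l + (2 * n).+1) chi_end w = 0.
    apply/eqP; rewrite eq_le; apply/andP; split; last first.
      by apply: extensions_ge0 => ? _; exact: chi_end_ge0.
    by rewrite -z; apply: le_extensions => v _ _; exact: chi_end_le_chi.
  by rewrite z z' !mulr0 lexx.
have [s [s1 s2 [u [s3 s4]]]] := synchronize n0 wn hw.
have restart g : g = chi \/ g = chi_end ->
    extensions 0 l g (w ++ s) = extensions 0 l g [:: 0%N].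
  by move=> hg; rewrite s3; apply: extensions_restart; rewrite -?s3.
have hN := hD l w; rewrite -/c in hN.
set N := extensions 0 (l + (2 * n).+1) chi w in hN *.
have N0 : 0 <= N by exact: extensions_ge0.
(* Of a sum of nonnegative terms only the prolongation by [s] is kept; [(1, -a)] and [(-1, b)] give
   the lower and upper bounds. *)
have key (x y : R) : (forall v, all (in_range 0) v ->
     0 <= x * extensions 0 l chi_end v + y * extensions 0 l chi v) ->
   x * e + y * c <= x * extensions 0 (l + (2 * n).+1) chi_end w + y * N.
  move=> pos; rewrite /N addnC !extensionsD -extensions_lin.
  have := @extensions_term 0 (fun v => x * extensions 0 l chi_end v +
    y * extensions 0 l chi v) w s.
  rewrite s1 !restart; [|by left|by right]; apply=> // v vn.
  by apply: pos; rewrite all_cat wn.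
have := key 1 (- a); have := key (-1) b; rewrite er => k1 k2.
have {}k1 : - 1 * (r * c) + b * c <=
    -1 * extensions 0 (l + (2 * n).+1) chi_end w + b * N.
  by apply: k1 => v /h /andP[_]; lra.
have {}k2 : 1 * (r * c) - a * c <=
    1 * extensions 0 (l + (2 * n).+1) chi_end w - a * N.
  by rewrite -!mulNr; apply: k2 => v /h /andP[+ _]; rewrite mulNr; lra.
have dN : d * N <= c by rewrite -ler_pdivlMl ?invr_gt0 // invrK.
have h1 : (r - a) * (d * N) <= (r - a) * c by rewrite ler_wpM2l // subr_ge0.
have h2 : (b - r) * (d * N) <= (b - r) * c by rewrite ler_wpM2l // subr_ge0.
by apply/andP; split; [move: h1 k2 | move: h2 k1]; rewrite /N; lra.
Qed.

Lemma bracketed_geometric : (0 < n)%N -> exists q : R, [/\ 0 <= q, q < 1 &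
  forall j, exists a b, b - a <= q ^+ j /\ forall k, bracketed a b (j * (2 * n).+1 + k)].
Proof.
move=> n0; have [q [q0 q1 hq]] := bracketed_contraction n0.
exists q; split=> // j.
suff [a [b [_ h1 h2]]] : exists a b, [/\ a <= b, b - a <= q ^+ j &
    bracketed a b (j * (2 * n).+1)].
  by exists a, b; split=> // k; exact: bracketedD.
elim: j => [|j [a [b [ab hab hb]]]].
  by exists 0, 1; split; [exact: ler01 | rewrite subr0 | exact: bracketed0].
have [a' [b' [ab' h' hb']]] := hq a b _ ab hb.
exists a', b'; split=> //; last by rewrite mulSnr.
by apply: le_trans h' _; rewrite exprS ler_wpM2l.
Qed.

(** * At least half of the maximal words can be prolonged by 0 *)

Fixpoint all_words k : seq (seq nat) :=
  if k is l.+1 then [seq j :: v | j <- index_iota 0 n, v <- all_words l]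
  else [:: [::]].

Lemma mem_all_words k v :
  (v \in all_words k) = (size v == k) && all (in_range 0) v.
Proof.
elim: k v => [|k IH] [|j v] //=.
  by apply/negbTE/negP => /allpairsP[[? ?] []].
apply/allpairsP/idP => [[[i u] /= [+ + [-> ->]]]|].
  by rewrite mem_index_iota IH eqSS /in_range => /= -> /andP[-> ->].
rewrite eqSS => /and3P[vk jn vn]; exists (j, v) => /=.
by rewrite mem_index_iota IH vk vn.
Qed.

Lemma all_words_uniq k : uniq (all_words k).
Proof.
elim: k => //= k IH; apply: allpairs_uniq => //; first exact: iota_uniq.
by move=> [i u] [j v] _ _ /= [-> ->].
Qed.

Lemma extensions_count k (P : pred (seq nat)) w :
  extensions 0 k (fun v => (P v)%:R) w =
  (count (fun v => P (w ++ v)) (all_words k))%:R.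
Proof.
have -> : extensions 0 k (fun v => (P v)%:R) w =
    \sum_(v <- all_words k) (P (w ++ v))%:R.
  elim: k w => [|k IH] w; first by rewrite big_seq1 cats0.
  rewrite extensionsS /= big_allpairs_dep /=; apply: eq_bigr => j _.
  by rewrite IH; apply: eq_bigr => v _; rewrite cat_rcons.
elim: (all_words k) => [|v s IH]; first by rewrite big_nil.
by rewrite big_cons IH /= natrD.
Qed.

Definition appendable w := `[< maxlex (w ++ [:: 0%N]) >].
Definition unappendable w := `[< maxlex w >] && ~~ appendable w.

(* x 0 1 |-> x 0 0 and x 0 1 2 y |-> x 0 1 1 y', where y' is y shifted down *)
Definition lower (w : seq nat) : seq nat :=
  let i := (size w - index 0%N (rev w))%N in
  let y := behead (drop i w) in
  take i w ++ (if y is [::] then [:: 0] else 1 :: map predn y)%N.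

Lemma lowerE (x y : seq nat) : 0%N \notin y ->
  lower (x ++ [:: 0, 1 & y]%N) =
  x ++ 0%N :: (if y is [::] then [:: 0] else 1 :: map predn y)%N.
Proof.
move=> y0; set v := (1 :: y)%N; have v0 : 0%N \notin v by rewrite inE.
have i : (size (x ++ 0 :: v) - index 0 (rev (x ++ 0 :: v)) = (size x).+1)%N.
  rewrite rev_cat rev_cons -cats1 -catA index_cat mem_rev (negbTE v0).
  by rewrite size_rev size_cat /=; lia.
rewrite /lower i -cat_rcons take_cat drop_cat !size_rcons ltnn subnn take0.
by rewrite drop0 cats0 /= -cats1 -catA.
Qed.

(** The first letter of [y] is at least 2 by the obstruction and at most 2 by [maxlex_step]. *)
Lemma unappendableP w : unappendable w -> exists x y,
  [/\ w = x ++ [:: 0, 1 & y]%N, all (fun i => 1 < i)%N y, maxlex w &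
    y <> [::] -> exists2 z, y = [:: 2%N & map S z] & all (fun i => 0 < i)%N z].
Proof.
move=> /andP[/asboolP mw /asboolP nw].
have [x [y [e hy]]] := not_maxlex_rcons_zero mw nw.
exists x, y; split=> //; case: y e hy => // i y e /= /andP[i1 hy] _.
have i2 : (i <= 2)%N.
  by apply: (@maxlex_step (x ++ [:: 0%N]) 1 i y); rewrite -catA; rewrite e in mw.
have -> : i = 2%N by lia.
exists (map predn y).
  rewrite -map_comp -[in LHS](map_id y); congr cons.
  by apply/eq_in_map => j /(allP hy) /=; lia.
by rewrite all_map; apply: sub_all hy => j /=; lia.
Qed.

Lemma lower_appendable w : unappendable w ->
  [/\ appendable (lower w), size (lower w) = size w &
      all (in_range 0) w -> all (in_range 0) (lower w)].
Proof.
move=> /unappendableP[x [y [-> hy mw hz]]].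
have y0 : 0%N \notin y by apply/negP => /(allP hy).
rewrite (lowerE _ y0); case: y hy y0 mw hz => [|i y] hy y0 mw hz.
  split.
  - by apply/asboolP; rewrite -catA; exact: maxlex_lower_nil.
  - by rewrite !size_cat.
  - by rewrite !all_cat /= => /and4P[-> -> _ _].
have [//|z e z0] := hz; rewrite e in mw *; split.
- apply/asboolP; rewrite -catA /= -map_comp map_id.
  exact: maxlex_lower.
- by rewrite !size_cat /= !size_map.
- rewrite !all_cat /= -map_comp map_id all_map => /and5P[-> -> h1 _ zn].
  by rewrite h1 /=; apply: sub_all zn => j; rewrite /in_range /=; lia.
Qed.

(** The image ends in 0 exactly when [y] is empty. Otherwise its last 0 locates [x], and the
    downward shift is reversible on letters at least 2. *)
Lemma lower_inj : {in unappendable &, injective lower}.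
Proof.
move=> w w' /unappendableP[x [y [-> hy _ _]]] /unappendableP[x' [y' [-> hy' _ _]]].
have pos s : all (fun i => 1 < i)%N s -> 0%N \notin s /\ 0%N \notin map predn s.
  move=> hs; split; first by apply/negP => /(allP hs).
  by apply/negP => /mapP[i /(allP hs)]; lia.
have [y0 py0] := pos _ hy; have [y0' py0'] := pos _ hy'.
rewrite !lowerE // => e.
have inj (s s' : seq nat) : all (fun i => 1 < i)%N s ->
    all (fun i => 1 < i)%N s' -> map predn s = map predn s' -> s = s'.
  elim: s s' => [|i s IH] [|i' s'] //= /andP[hi hs] /andP[hi' hs'] [ii ss].
  by rewrite (IH s') //; congr cons; lia.
case: y y' e hy hy' y0 y0' py0 py0' => [|i y] [|i' y'] e hy hy' y0 y0' py0 py0'.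
- have {}e : rcons (x ++ [:: 0%N]) 0%N = rcons (x' ++ [:: 0%N]) 0%N.
    by rewrite -!cats1 -!catA.
  have /= e2 := congr1 fst (rcons_inj e).
  by have [-> _] := @last_occurrence_inj 0%N x [::] x' [::] e2 isT isT.
- have {}e : (x ++ [:: 0%N]) ++ [:: 0%N] = x' ++ 0%N :: (1%N :: map predn (i' :: y')).
    by rewrite -catA.
  by have [] := last_occurrence_inj e isT; rewrite ?inE.
- have {}e : x ++ 0%N :: (1%N :: map predn (i :: y)) = (x' ++ [:: 0%N]) ++ [:: 0%N].
    by rewrite -catA.
  by have [] := last_occurrence_inj e; rewrite ?inE.
- have [||-> [/= ii yy]] := last_occurrence_inj e; rewrite ?inE //.
  by rewrite (inj (i :: y) (i' :: y')) //= ii yy.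
Qed.

Lemma count_unappendable k :
  (count unappendable (all_words k) <= count appendable (all_words k))%N.
Proof.
rewrite -!size_filter -(size_map lower); apply: uniq_leq_size.
  rewrite map_inj_in_uniq ?filter_uniq ?all_words_uniq // => w w'.
  rewrite !mem_filter => /andP[hw _] /andP[hw' _]; exact: lower_inj.
move=> _ /mapP[w + ->]; rewrite !mem_filter !mem_all_words.
move=> /andP[/lower_appendable[h1 h2 h3] /andP[h4 h5]].
by rewrite h1 h2 h4 h3.
Qed.

(** Unappendable words are at most as many as appendable ones, and each appendable word yields a
    maximal word one letter longer ending in 0. *)
Lemma words_le_double k : (0 < n)%N ->
  words 0 k <= 2 * extensions 0 k.+1 chi_end [::].
Proof.
move=> n0.
have h1 : words 0 k = (count (fun w => `[< maxlex w >]) (all_words k))%:R.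
  by rewrite -(@extensions_count k (fun w => `[< maxlex w >]) [::]).
have h2 : (count appendable (all_words k))%:R <= extensions 0 k.+1 chi_end [::].
  rewrite -(@extensions_count k appendable [::]) -addn1 extensionsD.
  apply: le_extensions => v _ _ /=.
  have := @extensions_term 0 chi_end v [:: 0%N] (fun _ _ => chi_end_ge0 _).
  rewrite /= /in_range n0 => /(_ isT); apply: le_trans.
  by rewrite /chi_end /appendable last_cat /= eqxx andbT.
rewrite h1; apply: (@le_trans _ _ (2 * (count appendable (all_words k))%:R)); last first.
  by rewrite ler_wpM2l.
rewrite -natrM ler_nat mul2n -addnn.
have := count_unappendable k.
rewrite -(leq_add2l (count appendable (all_words k))).
apply: leq_trans; rewrite -count_predUI.
rewrite (@eq_count _ (predI _ _) pred0) ?count_pred0 ?addn0.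
  apply: sub_count => w /= mw; rewrite /unappendable mw /=.
  by case: appendable.
by move=> w /=; rewrite /unappendable; case: appendable; rewrite ?andbF.
Qed.

End Counting.

(** * Braid words on ordinals and the limit *)

Lemma braid_equiv_weq n (u v : seq 'I_n) :
  braid_equiv u v -> weq (map val u) (map val v).
Proof.
elim=> {u v} [u v w w' h|w|w w' _|w1 w2 w3 _ h1 _ h2].
- rewrite !map_cat; apply: weq_catl; apply: weq_catr.
  by case: h => i j h /=; [exact: weq_far | exact: weq_adj].
- exact: weq_refl.
- exact: weq_sym.
- exact: weq_trans h1 h2.
Qed.

(** Equivalent words have the same letters, so the middle word of a [weq_trans] stays on [n]
    generators. *)
Lemma weq_lift n (u : seq 'I_n) w : weq (map val u) w ->
  exists v : seq 'I_n, w = map val v.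
Proof.
move=> /weq_mem uw; suff : {subset w <= gtn n}.
  elim: w {uw} => [|i w IH] wn; first by exists [::].
  have [|v ->] := IH; first by move=> j jw; apply: wn; rewrite inE jw orbT.
  by exists (Ordinal (wn i (mem_head _ _)) :: v).
by move=> j; rewrite -uw => /mapP[i _ ->]; exact: (ltn_ord i).
Qed.

Lemma weq_braid_equiv n (u v : seq 'I_n) :
  weq (map val u) (map val v) -> braid_equiv u v.
Proof.
have inj := inj_map (@val_inj _ _ 'I_n).
move eu: (map val u) => a; move ev: (map val v) => b h.
elim: h u v eu ev => {a b}
  [i j w f|i j w f|i w w' _ IH|w|w w' _ IH|w1 w2 w3 h1 IH1 _ IH2].
- case=> [//|i1 [//|j1 u]] [|i2 [//|j2 v]] //= [e1 e2 e3] [e4 e5 e6].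
  have [? ? ?] : [/\ i2 = j1, j2 = i1 & v = u].
    by split; [apply/val_inj | apply/val_inj | apply/inj]; rewrite /= ?e1 ?e2 ?e3.
  subst; apply: (@braid_equiv_step _ [::] u [:: i1; j1] [:: j1; i1]).
  exact: braid_far.
- case=> [//|i1 [//|j1 [//|k1 u]]] [|i2 [//|j2 [//|k2 v]]] //=.
  move=> [e1 e2 e3 e4] [e5 e6 e7 e8].
  have [? ? ? ? ?] : [/\ i2 = j1, j2 = i1, k2 = j1, k1 = i1 & v = u].
    by split; [apply/val_inj..| apply/inj]; rewrite /= ?e5 ?e6 ?e7 ?e8 ?e1 ?e2 ?e3.
  subst; apply: (@braid_equiv_step _ [::] u [:: i1; j1; i1] [:: j1; i1; j1]).
  exact: braid_adjacent.
- case=> [//|i1 u] [|i2 v] //= [e1 e2] [e3 e4].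
  have -> : i2 = i1 by apply/val_inj; rewrite /= e1.
  apply: (@braid_equiv_cat _ [:: i1] [:: i1]); first exact: braid_equiv_refl.
  exact: IH.
- move=> u v eu ev; have -> : u = v by apply: inj; rewrite eu.
  exact: braid_equiv_refl.
- by move=> u v eu ev; apply: braid_equiv_sym; exact: IH.
- move=> u v eu ev; have [w e] : exists w : seq 'I_n, w2 = map val w.
    by apply: (@weq_lift n u); rewrite eu.
  by apply: braid_equiv_trans (IH1 _ _ eu _) (IH2 _ _ _ ev); rewrite e.
Qed.

(** A left divisor [j] yields a representative starting with [j], so maximality bounds it by the
    first letter. Conversely, compare first letters and, when they agree, cancel them and
    recurse. *)
Lemma max_lex_repP n (w : seq 'I_n) :
  (exists b, is_max_lex_rep b w) <-> maxlex (map val w).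
Proof.
split=> [[b [<-]]|hw].
- elim: w => // i w IH max_w.
  have {}max_w v : weq (map val v) (map val (i :: w)) ->
      ((v : seqlexi 'I_n) <= i :: w)%O.
    by move=> h; apply: max_w; apply/word_classP; exact: weq_braid_equiv.
  split; last first.
    apply: IH => v /word_classP/braid_equiv_weq vw.
    by have := max_w (i :: v) (weq_cons _ vw); rewrite lexi_cons lexx.
  move=> j [t /= h]; have [[|k v] e] := weq_lift (u := i :: w) h; first by [].
  move: h; rewrite -cat1s in e; rewrite [j :: t]e => /weq_sym/max_w.
  by rewrite lexi_cons => /andP[+ _]; case: e => ->.
- exists (word_class w); split=> // v /word_classP/braid_equiv_weq.
  elim: v w hw => [|j v IH] [|i w] // hw h; first by have := weq_size h.
  - case: hw => max_w hw; have ji : (val j <= val i)%N.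
      by apply: max_w; exists (map val v); exact: weq_sym.
    rewrite lexi_cons; apply/andP; split=> //; apply/implyP => ij.
    apply: IH => //; have e : val j = val i by apply/eqP; rewrite eqn_leq ji.
    by move: h; rewrite /= e => /cancel_cons.
Qed.

Lemma card_words n k (P : pred (seq nat)) :
  #|[set t : k.-tuple 'I_n | P (map val t)]%SET| = count P (all_words n k).
Proof.
rewrite cardsE cardE size_filter.
have /permP <- : perm_eq (map (map val) (map val (enum {: k.-tuple 'I_n})))
    (all_words n k).
  apply: uniq_perm => [||w].
  - rewrite map_inj_uniq; last exact: inj_map val_inj.
    by rewrite map_inj_uniq ?enum_uniq //; exact: val_inj.
  - exact: all_words_uniq.
  rewrite mem_all_words; apply/mapP/andP => [[_ /mapP[t _ ->] ->]|[/eqP wk wn]].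
    rewrite size_map size_tuple eqxx; split=> //.
    by rewrite all_map; apply/allP => i _; exact: (ltn_ord i).
  have [v e] : exists v : seq 'I_n, w = map val v.
    elim: w wn {wk} => [_|i w IH /= /andP[i_n /IH[v ->]]]; first by exists [::].
    by exists (Ordinal i_n :: v).
  exists v => //; have vk : size v == k by rewrite -wk e size_map.
  by apply/mapP; exists (Tuple vk) => //; rewrite mem_enum.
by rewrite !count_map; apply: eq_count => t /=; rewrite unfold_in.
Qed.

Lemma proportion_a1E (R : realType) n k :
  proportion_a1 R n k = extensions n 0 k (@chi_end R) [::] / words R n 0 k.
Proof.
rewrite /proportion_a1; congr (_ / _).
- rewrite (@extensions_count _ _ _ (fun w => `[< maxlex w >] && (last 1%N w == 0%N))).
  rewrite -card_words; congr (_%:R); apply: eq_card => t.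
  rewrite !inE; congr andb; first exact/asbool_equiv_eq/max_lex_repP.
  by case: (tval t) => //= i w; rewrite -(last_map val).
- rewrite /words (@extensions_count _ _ _ (fun w => `[< maxlex w >])).
  rewrite -card_words; congr (_%:R); apply: eq_card => t.
  rewrite !inE; exact/asbool_equiv_eq/max_lex_repP.
Qed.

(** * Existence of the limit and the lower bound *)

Lemma small_power (R : realType) (q e : R) : 0 <= q -> q < 1 -> 0 < e ->
  exists j, q ^+ j < e.
Proof.
move=> q0 q1 e0; have h : `|q| < 1 by rewrite ger0_norm.
have [j _ hj] := cvgr_dist_lt _ _ (cvg_expr h) e e0.
exists j; have /= := hj j (leqnn j).
by rewrite sub0r normrN ger0_norm // exprn_ge0.
Qed.

Lemma words_ge1 (R : realType) n k : (0 < n)%N -> 1 <= words R n 0 k.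
Proof.
move=> n0; have <- : chi R (nseq k 0%N) = 1.
  apply: chi1; case: k => // k; exact: (@maxlex_nseq [::] 0 k (maxlex1 0)).
rewrite -{2}(size_nseq k 0%N) -[X in chi _ X]cat0s; apply: extensions_term.
  by move=> v _; exact: chi_ge0.
by rewrite all_nseq /in_range n0 orbT.
Qed.

(** Brackets at the empty word confine all late terms to an interval of length at most [q ^+ j], so
    the sequence is Cauchy. *)
Lemma cvg_proportion (R : realType) n : (0 < n)%N ->
  cvgn (proportion_a1 R n).
Proof.
move=> n0; apply/cauchy_cvgP; apply: cauchy_exP => e e0.
have [q [q0 q1 hq]] := bracketed_geometric R n0.
have [j hj] := small_power q0 q1 e0.
have [a [b [ab h]]] := hq j.
have bnd k : (j * (2 * n).+1 <= k)%N -> a <= proportion_a1 R n k <= b.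
  move=> /subnKC <-; have /andP[] := h (k - j * (2 * n).+1)%N [::] isT.
  rewrite proportion_a1E; set N := (_ + _)%N.
  have N0 : 0 < words R n 0 N by apply: lt_le_trans (words_ge1 R N n0).
  by rewrite ler_pdivlMr // ler_pdivrMr // => -> ->.
exists (proportion_a1 R n (j * (2 * n).+1)).
exists (j * (2 * n).+1)%N => // k /= jk; rewrite /ball /= ltr_norml.
have /andP[] := bnd _ (leqnn _); have /andP[] := bnd _ jk.
by move=> *; apply/andP; split; lra.
Qed.

Theorem theorem5p4 (R : realType) (n : nat) (hn : (1 <= n)%N) :
  1 / 8 < P_n1 R n.
Proof.
have n0 : (0 < n)%N := hn; rewrite ltNge; apply/negP => P8.
have /= lim := @cvg_proportion R n n0.
pose g : R := growth_bound R n.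
have g1 : 1 <= g := growth_bound_ge1 R n.
have g4 : g < 4 := growth_bound_lt4 R n.
(* Strictly between the growth bound and 4: if the limit is at most 1/8, it is below
   [1 / (2 * m)]. *)
pose m := (g + 4) / 2.
have [gm m4] : g < m /\ m < 4 by rewrite /m; split; lra.
have m0 : 0 < m by lra.
have lt_m : P_n1 R n < (2 * m)^-1.
  apply: le_lt_trans P8 _; rewrite div1r ltf_pV2 ?posrE; lra.
have [K _ hK] := cvgr_lt _ lim _ lt_m.
(* At least half of [words k] words of length [k.+1] end in 0, yet these are less than a fraction
   [1 / (2 * m)] of their length. *)
have step k : (K <= k)%N -> m * words R n 0 k <= words R n 0 k.+1.
  move=> Kk; have /= := hK k.+1 (leqW Kk); rewrite proportion_a1E.
  have N0 : 0 < words R n 0 k.+1 by apply: lt_le_trans (words_ge1 R k.+1 n0).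
  rewrite ltr_pdivrMr // mulrC ltr_pdivlMr; last lra.
  have := words_le_double R k n0; nra.
have grow i : m ^+ i <= words R n 0 (K + i).
  elim: i => [|i IH]; first by rewrite expr0; exact: words_ge1.
  rewrite addnS exprS; apply: le_trans (step _ (leq_addr _ _)).
  by rewrite ler_wpM2l // ltW.
have [C hC] := words_growth R n.
have C0 : 0 < C * g ^+ K.
  by have := hC K; have := words_ge1 R K n0; rewrite -/g; lra.
have gm0 : 0 <= g / m by rewrite divr_ge0; lra.
have gm1 : g / m < 1 by rewrite ltr_pdivrMr ?mul1r.
(* Growth by [m > g] at each step from [K] on must overtake the bound [C * g ^+ (K + i)]. *)
have [i hi] : exists i, (g / m) ^+ i < (C * g ^+ K)^-1.
  by apply: small_power; rewrite ?invr_gt0.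
have mi : 0 < m ^+ i by exact: exprn_gt0.
have : m ^+ i <= (C * g ^+ K) * g ^+ i.
  by apply: le_trans (grow i) _; rewrite -mulrA -exprD; exact: hC.
rewrite leNgt => /negP; apply.
by move: hi; rewrite expr_div_n ltr_pdivrMr // ltr_pdivlMl.
Qed.
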